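(* Let $\mathbf k$ be a commutative $\mathbb Q$-algebra and let $\mu\in\mathbf k^\times$. Then $M_\mu(\mathbf k)\subset \mathsf{DMR}_\mu(\mathbf k)$ (an inclusion of subsets of $\hat{\mathcal V}^{\mathrm{DR}}=\mathbf k\langle\langle e_0,e_1\rangle\rangle$).
   Context: **The algebra $\mathcal V^{\mathrm{DR}}$.** Let $\mathcal V^{\mathrm{DR}}$ be the free associative unital $\mathbf k$-algebra over generators $e_0,e_1$, graded with $\deg e_0=\deg e_1=1$. For a $\mathbb Z_{\ge 0}$-graded $\mathbf k$-module $X$, $\hat X$ (or $X^\wedge$) denotes its degree completion; the same notation is used for completions of graded morphisms. Thus $\hat{\mathcal V}^{\mathrm{DR}}=\mathbf k\langle\langle e_0,e_1\rangle\rangle$. For $g\in\hat{\mathcal V}^{\mathrm{DR}}$ and $w$ a word in $e_0,e_1$, $(g|w)\in\mathbf k$ is the coefficient of $w$ in $g$, so $g=\sum_w (g|w)w$. Let $\Delta^{\mathcal V,\mathrm{DR}}:\mathcal V^{\mathrm{DR}}\to(\mathcal V^{\mathrm{DR}})^{\otimes 2}$ be the algebra morphism with $e_i\mapsto e_i\otimes 1+1\otimes e_i$ ($i=0,1$). **$\mathcal W^{\mathrm{DR}}$ and $\mathcal M^{\mathrm{DR}}$.** Let $\mathcal W^{\mathrm{DR}}:=\mathbf k1\oplus\mathcal V^{\mathrm{DR}}e_1\subset\mathcal V^{\mathrm{DR}}$; it is a graded subalgebra, freely generated as an associative algebra by $y_n:=-e_0^{n-1}e_1$, $n\ge1$. Let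 $\Delta^{\mathcal W,\mathrm{DR}}:\mathcal W^{\mathrm{DR}}\to(\mathcal W^{\mathrm{DR}})^{\otimes2}$ be the algebra morphism with $y_n\mapsto\sum_{i=0}^n y_i\otimes y_{n-i}$ for $n\geq 1$, where $y_0:=1$. Let $\mathcal M^{\mathrm{DR}}:=\mathcal V^{\mathrm{DR}}/\mathcal V^{\mathrm{DR}}e_0$, a graded left $\mathcal V^{\mathrm{DR}}$-module (action denoted $\cdot$), and let $1_{\mathrm{DR}}\in\mathcal M^{\mathrm{DR}}$ be the class of $1$. By restriction $\mathcal M^{\mathrm{DR}}$ is a left $\mathcal W^{\mathrm{DR}}$-module, free of rank one generated by $1_{\mathrm{DR}}$. Let $\Delta^{\mathcal M,\mathrm{DR}}:\mathcal M^{\mathrm{DR}}\to(\mathcal M^{\mathrm{DR}})^{\otimes2}$ be the $\mathbf k$-module morphism such that $\Delta^{\mathcal M,\mathrm{DR}}(a\cdot1_{\mathrm{DR}})=\Delta^{\mathcal W,\mathrm{DR}}(a)\cdot 1_{\mathrm{DR}}^{\otimes2}$ for $a\in\mathcal W^{\mathrm{DR}}$. **Group-like elements.** $\mathcal G(\hat{\mathcal V}^{\mathrm{DR}})$ (resp. $\mathcal G(\hat{\mathcal M}^{\mathrm{DR}})$) is the set of group-like elements of $\hat{\mathcal V}^{\mathrm{DR}}$ (resp. $\hat{\mathcal M}^{\mathrm{DR}}$) for the completed coproduct $\hat\Delta^{\mathcal V,\mathrm{DR}}$ (resp. $\hat\Delta^{\mathcal M,\mathrm{DR}}$). **Double shuffle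 set.** For $g\in\hat{\mathcal V}^{\mathrm{DR}}$ set $\Gamma_g(t):=\exp\big(\sum_{n\ge1}(-1)^{n+1}(g|e_0^{n-1}e_1)t^n/n\big)\in\mathbf k[[t]]^\times$. For $\mu\in\mathbf k$, $\mathsf{DMR}_\mu(\mathbf k)$ is the set of $\Phi\in\hat{\mathcal V}^{\mathrm{DR}}$ such that $$\Phi\in\mathcal G(\hat{\mathcal V}^{\mathrm{DR}}),\quad (\Gamma_\Phi(-e_1)^{-1}\Phi)\cdot1_{\mathrm{DR}}\in\mathcal G(\hat{\mathcal M}^{\mathrm{DR}}),\quad (\Phi|e_0)=(\Phi|e_1)=0,\quad (\Phi|e_0e_1)=\mu^2/24.$$ **Associators.** Let $\mathfrak p_5$ be the graded $\mathbf k$-Lie algebra with generators $e_{ij}$, $1\le i\ne j\le5$ (of degree 1), and relations $e_{ji}=e_{ij}$, $[e_{ij},e_{kl}]=0$ for $i,j,k,l$ distinct, and $\sum_{j\in\{1,\dots,5\}\setminus\{i\}}e_{ij}=0$ for each $i$. Put $e_{i,j}:=e_{ij}$, $e_{ij,k}:=e_{ik}+e_{jk}$ and $e_{i,jk}:=e_{jk,i}=e_{ij}+e_{ik}$. For $(I,J,K)$ one of $(2,3,4),(12,3,4),(1,23,4),(1,2,34),(1,2,3)$, let $x\mapsto x^{I,J,K}$ be the continuous algebra morphism $\hat{\mathcal V}^{\mathrm{DR}}\to U(\mathfrak p_5)^\wedge$ with $e_0\mapsto e_{I,J}$, $e_1\mapsto e_{J,K}$. For $\mu\in\mathbf k^\times$,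 $$M_\mu(\mathbf k):=\Big\{\Phi\in\mathcal G(\hat{\mathcal V}^{\mathrm{DR}})\ \Big|\ \Phi^{2,3,4}\Phi^{1,23,4}\Phi^{1,2,3}=\Phi^{1,2,34}\Phi^{12,3,4},\ (\Phi|e_0)=(\Phi|e_1)=0,\ (\Phi|e_0e_1)=\tfrac{\mu^2}{24}\Big\}.$$ *)

(* Defs.v *)
From HB Require Import structures.
From mathcomp Require Import all_boot all_order all_algebra.
From mathcomp Require Import boolp.

Set Implicit Arguments.
Unset Strict Implicit.
Unset Printing Implicit Defensive.

Import GRing.Theory.
Local Open Scope ring_scope.
Local Open Scope quotient_scope.

(* The letters e_0 and e_1 are encoded by false and true. *)
Definition word := seq bool.

Section Series.
Variable k : comNzRingType.

(* k<<e_0, e_1>>; the coefficient (g|w) is g w. *)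
Definition Vhat := word -> k.
(* The completion of V (x) V, with basis the pairs of words u (x) v. *)
Definition V2hat := word -> word -> k.

Definition smono (u : word) : Vhat := fun w => (w == u)%:R.
Definition sone : Vhat := smono [::].
Definition sopp (f : Vhat) : Vhat := fun w => - f w.
Definition smul (f g : Vhat) : Vhat :=
  fun w => \sum_(i < (size w).+1) f (take i w) * g (drop i w).
Definition spow (f : Vhat) (n : nat) : Vhat := iter n (smul f) sone.

Definition tens (f g : Vhat) : V2hat := fun u v => f u * g v.
Definition sone2 : V2hat := tens sone sone.
Definition smul2 (F G : V2hat) : V2hat := fun u v =>
  \sum_(i < (size u).+1) \sum_(j < (size v).+1)
    F (take i u) (take j v) * G (drop i u) (drop j v).

Definition prim (a : bool) : V2hat := fun u v =>
  tens (smono [:: a]) sone u v + tens sone (smono [:: a]) u v.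
Definition DeltaV_word (w : word) : V2hat :=
  foldr (fun a => smul2 (prim a)) sone2 w.

(* Delta is homogeneous, so only the words w of length |u| + |v| contribute
   to the coefficient of u (x) v. *)
Definition DeltaV (g : Vhat) : V2hat := fun u v =>
  \sum_(w : (size u + size v).-tuple bool) g w * DeltaV_word w u v.

Definition grouplikeV (g : Vhat) : Prop :=
  DeltaV g =2 tens g g /\ g [::] = 1.

(* The completion of W = k1 + V e_1 consists of the series supported on the
   words w such that [last true w], i.e. that are empty or end with e_1. *)

Definition y (n : nat) : Vhat :=
  if n is m.+1 then sopp (smono (rcons (nseq m false) true)) else sone.
Definition Deltay (n : nat) : V2hat := fun u v =>
  \sum_(i < n.+1) tens (y i) (y (n - i)) u v.

(* If w is empty or ends with e_1, and [yblocks 0 w] is [:: n_1; ...; n_r], then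
   w = e_0^(n_1 - 1) e_1 ... e_0^(n_r - 1) e_1 = (-1)^r y_{n_1} ... y_{n_r};
   see [yblocksK]. The argument n counts the letters e_0 already read. *)
Fixpoint yblocks (n : nat) (w : word) : seq nat :=
  match w with
  | [::] => [::]
  | false :: w' => yblocks n.+1 w'
  | true :: w' => n.+1 :: yblocks 0 w'
  end.

Definition DeltaW_word (w : word) : V2hat := fun u v =>
  let ns := yblocks 0 w in
  (-1) ^+ size ns * foldr (fun n => smul2 (Deltay n)) sone2 ns u v.

Definition DeltaW (a : Vhat) : V2hat := fun u v =>
  \sum_(w : (size u + size v).-tuple bool | last true w) a w * DeltaW_word w u v.

(* The completion of M = V / V e_0: the classes of the words that do not end
   with e_0 are a basis, and the class of a word ending with e_0 is 0. *)
Definition mword := {w : word | last true w}.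
Definition Mhat := mword -> k.
Definition M2hat := mword -> mword -> k.

Definition toM (g : Vhat) : Mhat := fun w => g (val w).
Definition toM2 (F : V2hat) : M2hat := fun u v => F (val u) (val v).

(* The lift of m that lies in (the completion of) W: it is the only a in W
   such that a . 1_DR = m. *)
Definition liftM (m : Mhat) : Vhat := fun w => if insub w is Some u then m u else 0.

Definition Mact (g : Vhat) (m : Mhat) : Mhat := toM (smul g (liftM m)).
Definition oneM : Mhat := toM sone.

(* Delta^M (a . 1_DR) = Delta^W (a) . (1_DR (x) 1_DR), and the class of
   F in M (x) M is F . (1_DR (x) 1_DR). *)
Definition DeltaM (m : Mhat) : M2hat := toM2 (DeltaW (liftM m)).

Definition grouplikeM (m : Mhat) : Prop :=
  (forall u v, DeltaM m u v = m u * m v) /\ liftM m [::] = 1.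

(* F(x) for F in k[[t]] and x a series without constant term *)
Definition ps_eval (F : nat -> k) (x : Vhat) : Vhat :=
  fun w => \sum_(n < (size w).+1) F n * spow x n w.

Definition is_inverse (g h : Vhat) : Prop :=
  smul g h =1 sone /\ smul h g =1 sone.

End Series.

Lemma yblocksK (w : word) : last true w ->
  flatten [seq rcons (nseq n.-1 false) true | n <- yblocks 0 w] = w.
Proof.
suff H n : last true w ->
    flatten [seq rcons (nseq m.-1 false) true | m <- yblocks n w] =
    if w is [::] then [::] else nseq n false ++ w.
  by move=> /(H 0); case: w {H}.
elim: w n => [|[] w IH] n //= lw.
  rewrite IH // cat_rcons; case: w {IH lw} => [|b w] //.
have nseqE : nseq n.+1 false = rcons (nseq n false) false by elim: n => //= n <-.
rewrite IH; last by case: w {IH} lw.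
by case: w {IH} lw => // b w _; rewrite nseqE cat_rcons.
Qed.

Section PowerSeries.
Variable k : comAlgType rat.

(* exp(f) for f in k[[t]] with f_0 = 0: the coefficient of t^n only involves
   the powers f^m with m <= n, and f modulo t^(n+1). *)
Definition ps_exp (f : nat -> k) : nat -> k := fun n =>
  \sum_(m < n.+1) (m`!%:R^-1 : rat) *: ((\poly_(i < n.+1) f i) ^+ m)`_n.

Definition Gamma (g : Vhat k) : nat -> k :=
  ps_exp (fun n => if n is m.+1
    then (n%:R^-1 : rat) *: ((-1) ^+ n.+1 * g (rcons (nseq m false) true))
    else 0).

End PowerSeries.

Definition DMR (k : comAlgType rat) (mu : k) (Phi : Vhat k) : Prop :=
  [/\ grouplikeV Phi,
      exists h, is_inverse (ps_eval (Gamma Phi) (sopp (smono k [:: true]))) h /\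
        grouplikeM (Mact (smul h Phi) (oneM k)),
      Phi [:: false] = 0,
      Phi [:: true] = 0 &
      Phi [:: false; true] = (24%:R^-1 : rat) *: mu ^+ 2].

(* The Lie algebra p_5 by generators and relations: the terms [lterm] modulo
   the congruence [p5_eq]. The index i : 'I_5 stands for the label i + 1. *)
Definition p5_gen := {p : 'I_5 * 'I_5 | p.1 != p.2}.

Inductive lterm (k : Type) : Type :=
| LGen of p5_gen
| LZero
| LAdd of lterm k & lterm k
| LScale of k & lterm k
| LBr of lterm k & lterm k.
Arguments LGen {k}.
Arguments LZero {k}.

(* e_ij for i != j; the value 0 for i = j is a convention. *)
Definition p5_e {k : Type} (i j : 'I_5) : lterm k :=
  if insub (i, j) is Some p then LGen p else LZero.

Section P5.
Variable k : comNzRingType.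

Inductive p5_eq : lterm k -> lterm k -> Prop :=
| p5_refl x : p5_eq x x
| p5_sym x x' : p5_eq x x' -> p5_eq x' x
| p5_trans x x' x'' : p5_eq x x' -> p5_eq x' x'' -> p5_eq x x''
| p5_add x x' z z' :
    p5_eq x x' -> p5_eq z z' -> p5_eq (LAdd x z) (LAdd x' z')
| p5_scale c x x' : p5_eq x x' -> p5_eq (LScale c x) (LScale c x')
| p5_br x x' z z' :
    p5_eq x x' -> p5_eq z z' -> p5_eq (LBr x z) (LBr x' z')
| p5_addA x z t : p5_eq (LAdd x (LAdd z t)) (LAdd (LAdd x z) t)
| p5_addC x z : p5_eq (LAdd x z) (LAdd z x)
| p5_add0 x : p5_eq (LAdd LZero x) x
| p5_addN x : p5_eq (LAdd (LScale (-1) x) x) LZero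
| p5_scaleA a b x : p5_eq (LScale a (LScale b x)) (LScale (a * b) x)
| p5_scale1 x : p5_eq (LScale 1 x) x
| p5_scaleDr a x z : p5_eq (LScale a (LAdd x z)) (LAdd (LScale a x) (LScale a z))
| p5_scaleDl a b x : p5_eq (LScale (a + b) x) (LAdd (LScale a x) (LScale b x))
| p5_brDl x z t : p5_eq (LBr (LAdd x z) t) (LAdd (LBr x t) (LBr z t))
| p5_brDr x z t : p5_eq (LBr x (LAdd z t)) (LAdd (LBr x z) (LBr x t))
| p5_brZl a x z : p5_eq (LBr (LScale a x) z) (LScale a (LBr x z))
| p5_brZr a x z : p5_eq (LBr x (LScale a z)) (LScale a (LBr x z))
| p5_brxx x : p5_eq (LBr x x) LZero
| p5_jacobi x z t :
    p5_eq (LAdd (LBr x (LBr z t)) (LAdd (LBr z (LBr t x)) (LBr t (LBr x z)))) LZero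
| p5_eC i j : i != j -> p5_eq (p5_e j i) (p5_e i j)
| p5_ebr i j l m :
    uniq [:: i; j; l; m] -> p5_eq (LBr (p5_e i j) (p5_e l m)) LZero
| p5_esum i :
    p5_eq (foldr (fun j => LAdd (p5_e i j)) LZero [seq j <- enum 'I_5 | j != i]) LZero.

(* The enveloping algebra U(p_5): the free k-algebra on p_5 modulo linearity of
   the inclusion [UIn] and [x, z] = x z - z x. *)
Inductive uterm : Type :=
| UIn of lterm k
| UConst of k
| UAdd of uterm & uterm
| UMul of uterm & uterm.

Inductive u_eq : uterm -> uterm -> Prop :=
| u_refl x : u_eq x x
| u_sym x x' : u_eq x x' -> u_eq x' x
| u_trans x x' x'' : u_eq x x' -> u_eq x' x'' -> u_eq x x''
| u_add x x' z z' : u_eq x x' -> u_eq z z' -> u_eq (UAdd x z) (UAdd x' z')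
| u_mul x x' z z' : u_eq x x' -> u_eq z z' -> u_eq (UMul x z) (UMul x' z')
| u_addA x z t : u_eq (UAdd x (UAdd z t)) (UAdd (UAdd x z) t)
| u_addC x z : u_eq (UAdd x z) (UAdd z x)
| u_add0 x : u_eq (UAdd (UConst 0) x) x
| u_addN x : u_eq (UAdd (UMul (UConst (-1)) x) x) (UConst 0)
| u_mulA x z t : u_eq (UMul x (UMul z t)) (UMul (UMul x z) t)
| u_mul1 x : u_eq (UMul (UConst 1) x) x
| u_mulDl x z t : u_eq (UMul (UAdd x z) t) (UAdd (UMul x t) (UMul z t))
| u_mulDr x z t : u_eq (UMul x (UAdd z t)) (UAdd (UMul x z) (UMul x t))
| u_constD a b : u_eq (UConst (a + b)) (UAdd (UConst a) (UConst b))
| u_constM a b : u_eq (UConst (a * b)) (UMul (UConst a) (UConst b))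
| u_constC a x : u_eq (UMul (UConst a) x) (UMul x (UConst a))
| u_in x x' : p5_eq x x' -> u_eq (UIn x) (UIn x')
| u_inD x z : u_eq (UIn (LAdd x z)) (UAdd (UIn x) (UIn z))
| u_inZ a x : u_eq (UIn (LScale a x)) (UMul (UConst a) (UIn x))
| u_inbr x z :
    u_eq (UIn (LBr x z))
      (UAdd (UMul (UIn x) (UIn z)) (UMul (UConst (-1)) (UMul (UIn z) (UIn x)))).

HB.instance Definition _ := gen_eqMixin uterm.
HB.instance Definition _ := gen_choiceMixin uterm.

Definition u_eqb : rel uterm := fun x z => `[< u_eq x z >].

Lemma u_eqb_refl : reflexive u_eqb.
Proof. by move=> x; apply/asboolP/u_refl. Qed.
Lemma u_eqb_sym : symmetric u_eqb.
Proof. by move=> x z; apply/asboolP/asboolP; apply: u_sym. Qed.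
Lemma u_eqb_trans : transitive u_eqb.
Proof. by move=> z x t /asboolP h /asboolP h'; apply/asboolP/(u_trans h). Qed.

Canonical u_equiv := EquivRel u_eqb u_eqb_refl u_eqb_sym u_eqb_trans.

Definition Up5 := {eq_quot u_eqb}.
HB.instance Definition _ := Choice.on Up5.
HB.instance Definition _ := EqQuotient.on Up5.

Definition up5 (x : uterm) : Up5 := \pi_Up5 x.

Lemma up5P x z : up5 x = up5 z <-> u_eq x z.
Proof. by split=> [/eqmodP/asboolP|h]; last by apply/eqmodP/asboolP. Qed.

Lemma up5_surj (a : Up5) : exists x, a = up5 x.
Proof. by exists (repr a); rewrite /up5 reprK. Qed.

Definition Up5_add (a b : Up5) : Up5 := up5 (UAdd (repr a) (repr b)).
Definition Up5_mul (a b : Up5) : Up5 := up5 (UMul (repr a) (repr b)).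
Definition Up5_opp (a : Up5) : Up5 := up5 (UMul (UConst (-1)) (repr a)).
Definition Up5_scale (c : k) (a : Up5) : Up5 := up5 (UMul (UConst c) (repr a)).

Lemma repr_up5 x : u_eq (repr (up5 x)) x.
Proof. by apply/up5P; rewrite {1}/up5 reprK. Qed.

Lemma Up5_addE x z : Up5_add (up5 x) (up5 z) = up5 (UAdd x z).
Proof. by apply/up5P/u_add; apply: repr_up5. Qed.
Lemma Up5_mulE x z : Up5_mul (up5 x) (up5 z) = up5 (UMul x z).
Proof. by apply/up5P/u_mul; apply: repr_up5. Qed.
Lemma Up5_oppE x : Up5_opp (up5 x) = up5 (UMul (UConst (-1)) x).
Proof. by apply/up5P/u_mul; [apply: u_refl | apply: repr_up5]. Qed.
Lemma Up5_scaleE c x : Up5_scale c (up5 x) = up5 (UMul (UConst c) x).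
Proof. by apply/up5P/u_mul; [apply: u_refl | apply: repr_up5]. Qed.

Let Up5E := (Up5_addE, Up5_mulE, Up5_oppE, Up5_scaleE).

Lemma Up5_addA : associative Up5_add.
Proof.
move=> a b c; case: (up5_surj a) (up5_surj b) (up5_surj c) => x -> [z ->] [t ->].
by rewrite !Up5E; apply/up5P/u_addA.
Qed.
Lemma Up5_addC : commutative Up5_add.
Proof.
move=> a b; case: (up5_surj a) (up5_surj b) => x -> [z ->].
by rewrite !Up5E; apply/up5P/u_addC.
Qed.
Lemma Up5_add0 : left_id (up5 (UConst 0)) Up5_add.
Proof. by move=> a; case: (up5_surj a) => x ->; rewrite !Up5E; apply/up5P/u_add0. Qed.
Lemma Up5_addN : left_inverse (up5 (UConst 0)) Up5_opp Up5_add.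
Proof. by move=> a; case: (up5_surj a) => x ->; rewrite !Up5E; apply/up5P/u_addN. Qed.

HB.instance Definition _ :=
  GRing.isZmodule.Build Up5 Up5_addA Up5_addC Up5_add0 Up5_addN.

Lemma Up5_mulA : associative Up5_mul.
Proof.
move=> a b c; case: (up5_surj a) (up5_surj b) (up5_surj c) => x -> [z ->] [t ->].
by rewrite !Up5E; apply/up5P/u_mulA.
Qed.
Lemma Up5_mul1l : left_id (up5 (UConst 1)) Up5_mul.
Proof. by move=> a; case: (up5_surj a) => x ->; rewrite !Up5E; apply/up5P/u_mul1. Qed.
Lemma Up5_mul1r : right_id (up5 (UConst 1)) Up5_mul.
Proof.
move=> a; case: (up5_surj a) => x ->; rewrite !Up5E; apply/up5P.
exact: u_trans (u_sym (u_constC _ _)) (u_mul1 _).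
Qed.
Lemma Up5_mulDl : left_distributive Up5_mul Up5_add.
Proof.
move=> a b c; case: (up5_surj a) (up5_surj b) (up5_surj c) => x -> [z ->] [t ->].
by rewrite !Up5E; apply/up5P/u_mulDl.
Qed.
Lemma Up5_mulDr : right_distributive Up5_mul Up5_add.
Proof.
move=> a b c; case: (up5_surj a) (up5_surj b) (up5_surj c) => x -> [z ->] [t ->].
by rewrite !Up5E; apply/up5P/u_mulDr.
Qed.

(* The augmentation shows that U(p_5) is not the zero ring. *)
Fixpoint u_aug (x : uterm) : k :=
  match x with
  | UIn _ => 0
  | UConst c => c
  | UAdd x z => u_aug x + u_aug z
  | UMul x z => u_aug x * u_aug z
  end.

Lemma u_aug_eq x z : u_eq x z -> u_aug x = u_aug z.
Proof.
elim=> {x z} //=.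
- by move=> x z t _ -> _ ->.
- by move=> x z t u _ -> _ ->.
- by move=> x z t u _ -> _ ->.
- by move=> *; rewrite addrA.
- by move=> *; rewrite addrC.
- by move=> *; rewrite add0r.
- by move=> *; rewrite mulN1r addNr.
- by move=> *; rewrite mulrA.
- by move=> *; rewrite mul1r.
- by move=> *; rewrite mulrDl.
- by move=> *; rewrite mulrDr.
- by move=> *; rewrite mulrC.
- by move=> *; rewrite addr0.
- by move=> *; rewrite mulr0.
- by move=> *; rewrite !mulr0 addr0.
Qed.

Lemma Up5_1neq0 : up5 (UConst 1) != 0 :> Up5.
Proof.
apply/eqP => /up5P /u_aug_eq /= h.
by have := oner_neq0 k; rewrite h eqxx.
Qed.

HB.instance Definition _ := GRing.Zmodule_isNzRing.Build Up5
  Up5_mulA Up5_mul1l Up5_mul1r Up5_mulDl Up5_mulDr Up5_1neq0.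

Lemma Up5_scaleA c d (a : Up5) : Up5_scale c (Up5_scale d a) = Up5_scale (c * d) a.
Proof.
case: (up5_surj a) => x ->; rewrite !Up5E; apply/up5P.
by apply: u_trans (u_mulA _ _ _) _; apply: u_mul (u_sym (u_constM _ _)) (u_refl _).
Qed.
Lemma Up5_scale1 : left_id 1 Up5_scale.
Proof. by move=> a; case: (up5_surj a) => x ->; rewrite !Up5E; apply/up5P/u_mul1. Qed.
Lemma Up5_scaleDr : right_distributive Up5_scale +%R.
Proof.
move=> c a b; case: (up5_surj a) (up5_surj b) => x -> [z ->].
by rewrite -![_ + _]/(Up5_add _ _) !Up5E; apply/up5P/u_mulDr.
Qed.
Lemma Up5_scaleDl (a : Up5) : {morph Up5_scale^~ a : c d / c + d}.
Proof.
move=> c d; case: (up5_surj a) => x ->.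
rewrite -[RHS]/(Up5_add _ _) !Up5E; apply/up5P.
exact: u_trans (u_mul (u_constD _ _) (u_refl _)) (u_mulDl _ _ _).
Qed.

HB.instance Definition _ := GRing.Zmodule_isLmodule.Build k Up5
  Up5_scaleA Up5_scale1 Up5_scaleDr Up5_scaleDl.

Lemma Up5_scaleAl (c : k) (a b : Up5) : c *: (a * b) = (c *: a) * b.
Proof.
case: (up5_surj a) (up5_surj b) => x -> [z ->].
rewrite -[LHS]/(Up5_scale _ (Up5_mul _ _)) -[RHS]/(Up5_mul (Up5_scale _ _) _).
by rewrite !Up5E; apply/up5P/u_mulA.
Qed.

HB.instance Definition _ := GRing.Lmodule_isLalgebra.Build k Up5 Up5_scaleAl.

Lemma Up5_scaleAr (c : k) (a b : Up5) : c *: (a * b) = a * (c *: b).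
Proof.
case: (up5_surj a) (up5_surj b) => x -> [z ->].
rewrite -[LHS]/(Up5_scale _ (Up5_mul _ _)) -[RHS]/(Up5_mul _ (Up5_scale _ _)).
rewrite !Up5E; apply/up5P/(u_trans (u_mulA _ _ _))/u_sym/(u_trans (u_mulA _ _ _)).
exact: u_mul (u_sym (u_constC _ _)) (u_refl _).
Qed.

HB.instance Definition _ := GRing.Lalgebra_isAlgebra.Build k Up5 Up5_scaleAr.

Lemma up5D x z : up5 (UAdd x z) = up5 x + up5 z.
Proof. by rewrite -Up5_addE. Qed.
Lemma up5M x z : up5 (UMul x z) = up5 x * up5 z.
Proof. by rewrite -Up5_mulE. Qed.
Lemma up5C c : up5 (UConst c) = c%:A.
Proof.
rewrite -[RHS]/(Up5_scale c (up5 (UConst 1))) Up5_scaleE; apply/up5P.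
exact: u_trans (u_sym (u_mul1 _)) (u_constC _ _).
Qed.

(* The completion of U(p_5) is the product over n of the components U(p_5)_n;
   an element is given by the sequence of its components. As U(p_5) is the
   direct sum of the U(p_5)_n, components are compared in U(p_5). *)
Definition Up5hat := nat -> Up5.

Definition cmul (x z : Up5hat) : Up5hat :=
  fun n => \sum_(i < n.+1) x i * z (n - i)%N.

Definition label (i : nat) : 'I_5 := inord i.-1.

(* e_{I,J} for disjoint sets of labels I and J *)
Definition e_ (I J : seq nat) : Up5 :=
  \sum_(i <- I) \sum_(j <- J) up5 (UIn (p5_e (label i) (label j))).

(* g |-> g^{I,J,K}. The images of e_0 and e_1 have degree 1, so the component
   of degree n comes from the words of length n. *)
Definition subst (g : Vhat k) (I J K : seq nat) : Up5hat := fun n =>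
  \sum_(w : n.-tuple bool) g w *: \prod_(a <- w) (if a then e_ J K else e_ I J).

Definition pentagon (Phi : Vhat k) : Prop :=
  cmul (cmul (subst Phi [:: 2]%N [:: 3]%N [:: 4]%N) (subst Phi [:: 1]%N [:: 2; 3]%N [:: 4]%N))
    (subst Phi [:: 1]%N [:: 2]%N [:: 3]%N)
  =1 cmul (subst Phi [:: 1]%N [:: 2]%N [:: 3; 4]%N) (subst Phi [:: 1; 2]%N [:: 3]%N [:: 4]%N).

End P5.

Definition associator (k : comAlgType rat) (mu : k) (Phi : Vhat k) : Prop :=
  [/\ grouplikeV Phi,
      pentagon Phi,
      Phi [:: false] = 0,
      Phi [:: true] = 0 &
      Phi [:: false; true] = (24%:R^-1 : rat) *: mu ^+ 2].

(* Main.v *)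
Require Import Defs.
From HB Require Import structures.
From mathcomp Require Import all_boot all_order all_algebra.
From mathcomp Require Import boolp ring zify.

Set Implicit Arguments.
Unset Strict Implicit.
Unset Printing Implicit Defensive.

Import GRing.Theory.
Local Open Scope ring_scope.

(** Why associators satisfy the double shuffle relations.

    Let H(x) = sum_n h_n x^n be the generating series of multiple polylogarithms,
    with values in the completion of M, and let S_m = sum_(n < m) h_n. The
    differential equation of H says that S_(m+1) = (1 + sum_n y_n / m^n) S_m, so
    S_m is group-like for the harmonic coproduct: this is the quasi-shuffle
    product of truncated sums. Hence the three functions
      q = sum_(n >= m) h_n (x) h_m x^n y^m,
      p = sum_m h_m (x) S_(m+1) (xy)^m,   r = sum_m S_m (x) h_m (xy)^m
    with values in M (x) M satisfy p + r = Delta H(xy). They are a solution of a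
    differential system with logarithmic poles along the boundary of M_(0,5), and
    the residues of that system are a representation of p_5 on triples (q, p, r).
    Only these residues are used below: they make sense on the triples of elements
    of any module with two commuting pairs of operators (E_0, E_1), (F_0, F_1), and
    the relations of p_5 are checked directly ([op_ij_comm], [op_ij_sum]).

    The pentagon is evaluated in this representation on the vector (o, o, 0), where
    o, the class 1 (x) 1, is killed by E_0 and F_0. Along the path with two edges,
    the solution keeps q = p, and p + r ends at the harmonic coproduct of Phi. Along
    the path with three edges, q + r becomes Phi (x) Phi after two edges; the last
    edge, which is contracted to the point (1, 1) by the coordinates x and y,
    divides it by a series C in the commuting elements E_1 and F_1. The outcome is
      Phi(F) Phi(E) o = C(E_1, F_1) Delta(Phi)     ([shuffle_harmonic]).

    It remains to compute C. The identity also holds when E_1 and F_1 are scalars, or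
    when one of the two pairs is itself the pair (M_0, M_1) of operators that computes
    the harmonic coproduct. Comparing the two ways to bracket three scalars shows that
    C is a 2-cocycle, C(x, y) C(x + y, z) = C(x, y + z) C(y, z). Its part of degree 1
    in z is a differential equation ([corr_series_ode]), whose solution is
    C(x, y) = h(x + y) / (h(x) h(y)) with h(t) = exp(sum_n (Phi|e_0^(n-1) e_1) t^n / n)
    ([corr_series_factor]). So h(e_1) Phi is group-like for the harmonic coproduct
    ([harmonic_twist]), and h(t) is 1 / Gamma_Phi(-t) ([gammaM]). *)

(** * Sums over words of a given length *)

(** The words of length n are enumerated as a list, so that sums over them split along
    the first or the last letter. *)
Fixpoint words (n : nat) : seq word :=
  if n is m.+1 then
    [seq false :: w | w <- words m] ++ [seq true :: w | w <- words m]
  else [:: [::]].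

Lemma mem_map_cons (a b : bool) (w : word) (s : seq word) :
  (b :: w \in [seq a :: v | v <- s]) = (b == a) && (w \in s).
Proof.
apply/mapP/andP => [[v vs [-> ->]]|[/eqP-> ws]]; first by rewrite eqxx.
by exists w.
Qed.

Lemma mem_words n w : (w \in words n) = (size w == n).
Proof.
elim: n w => [|n IH] [|b w] //=.
  by rewrite mem_cat; apply/negP => /orP[] /mapP[].
by rewrite mem_cat !mem_map_cons !IH eqSS; case: b; rewrite //= orbF.
Qed.

Lemma words_uniq n : uniq (words n).
Proof.
elim: n => //= n IH; have inj c : injective (cons c : word -> word) by move=> ? ? [].
rewrite cat_uniq !map_inj_uniq // IH andbT /=.
by apply/hasPn => w /mapP[w' _ ->]; apply/negP => /mapP[].
Qed.

Lemma big_tuple_words (V : nmodType) n (P : pred word) (F : word -> V) :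
  \sum_(w : n.-tuple bool | P w) F w = \sum_(w <- words n | P w) F w.
Proof.
rewrite -(big_map (@tval n bool) P F); apply: perm_big; apply: uniq_perm.
- by rewrite map_inj_uniq; [apply: index_enum_uniq | apply: val_inj].
- exact: words_uniq.
move=> w; rewrite mem_words; apply/mapP/eqP => [[t _ ->]|sw]; first exact: size_tuple.
by exists (tcast sw (in_tuple w)); [rewrite mem_index_enum | rewrite val_tcast].
Qed.

Lemma big_words0 (V : nmodType) (F : word -> V) : \sum_(w <- words 0) F w = F [::].
Proof. by rewrite big_seq1. Qed.

Lemma big_wordsS (V : nmodType) n (F : word -> V) :
  \sum_(w <- words n.+1) F w =
  \sum_(w <- words n) F (false :: w) + \sum_(w <- words n) F (true :: w).
Proof. by rewrite /= big_cat !big_map. Qed.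

Lemma big_words_rcons (V : nmodType) n (F : word -> V) :
  \sum_(w <- words n.+1) F w =
  \sum_(w <- words n) F (rcons w false) + \sum_(w <- words n) F (rcons w true).
Proof.
elim: n F => [|n IH] F; first by rewrite (big_wordsS 0) !big_words0.
rewrite (big_wordsS n (fun w => F (rcons w false))) (big_wordsS n (fun w => F (rcons w true))).
by rewrite (big_wordsS n.+1) (IH (fun w => F (false :: w))) (IH (fun w => F (true :: w))) addrACA.
Qed.

(** Both sides run over the triples of indices with sum n: this is the associativity of
    convolution products. *)
Lemma sum_triangle (V : nmodType) n (F : nat -> nat -> V) :
  \sum_(l < n.+1) \sum_(i < l.+1) F i (l - i)%N =
  \sum_(i < n.+1) \sum_(j < (n - i).+1) F i j.
Proof.
elim: n F => [|n IH] F; first by rewrite !big_ord1.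
rewrite big_ord_recr IH [RHS]big_ord_recr /= subnn big_ord1.
rewrite [X in _ + X]big_ord_recr /= subnn addrA; congr (_ + _).
rewrite -big_split; apply: eq_bigr => i _; rewrite subSn; last by rewrite -ltnS.
by rewrite [RHS]big_ord_recr.
Qed.

(** * Series acting degree by degree *)

(** Operators are plain functions with a proof of linearity, so that those defined by formulas
    from variables are used without further structure. *)
Section Linear.
Variables (k : comNzRingType) (V V' : lmodType k) (f : V -> V').
Hypothesis lf : linear f.

Definition lin_pack : {linear V -> V'} := HB.pack f (GRing.isLinear.Build _ _ _ _ f lf).

Lemma lin_sum I r (P : pred I) E :
  f (\sum_(i <- r | P i) E i) = \sum_(i <- r | P i) f (E i).
Proof. exact: (linear_sum lin_pack). Qed.
Lemma linD : {morph f : x y / x + y}. Proof. exact: (linearD lin_pack). Qed.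
Lemma linB : {morph f : x y / x - y}. Proof. exact: (linearB lin_pack). Qed.
Lemma linN : {morph f : x / - x}. Proof. exact: (linearN lin_pack). Qed.
Lemma lin0 : f 0 = 0. Proof. exact: (linear0 lin_pack). Qed.
Lemma linZ c : {morph f : x / c *: x}. Proof. exact: (linearZ_LR lin_pack). Qed.
End Linear.

Lemma lin_add (k : comNzRingType) (V V' : lmodType k) (f g : V -> V') :
  linear f -> linear g -> linear (fun x => f x + g x).
Proof. by move=> lf lg c x y; rewrite lf lg scalerDr addrACA. Qed.

Lemma lin_opp (k : comNzRingType) (V V' : lmodType k) (f : V -> V') :
  linear f -> linear (fun x => - f x).
Proof. by move=> lf c x y; rewrite lf opprD scalerN. Qed.


Section HomogeneousAction.
Variables (k : comNzRingType) (Phi : Vhat k).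

(** The component of degree n of Phi(P_0, P_1). Working with the components separately
    avoids any convergence question: modules need no topology. *)
Definition act_deg (V : lmodType k) (P : bool -> V -> V) (n : nat) (x : V) : V :=
  \sum_(w <- words n) Phi w *: foldr P x w.

(** The whole series Phi(P_0, P_1), acting on sequences of homogeneous components, P_0 and
    P_1 having degree 1. *)
Definition act_series (V : lmodType k) (P : bool -> V -> V) (x : nat -> V) (n : nat) : V :=
  \sum_(i < n.+1) act_deg P i (x (n - i)%N).

Definition const_seq (V : lmodType k) (x : V) (n : nat) : V :=
  if n is 0 then x else 0.

Section Intertwine.
Variables (V V' : lmodType k) (tau : V -> V').
Variables (P : bool -> V -> V) (Q : bool -> V' -> V').
Hypothesis ltau : linear tau.
Hypothesis PQ : forall a x, tau (P a x) = Q a (tau x).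

Lemma foldr_intertwine x w : tau (foldr P x w) = foldr Q (tau x) w.
Proof. by elim: w => //= a w <-. Qed.

Lemma act_deg_intertwine n x : tau (act_deg P n x) = act_deg Q n (tau x).
Proof.
rewrite /act_deg lin_sum //; apply: eq_bigr => w _.
by rewrite linZ // foldr_intertwine.
Qed.

Lemma act_series_intertwine x n : tau (act_series P x n) = act_series Q (tau \o x) n.
Proof. by rewrite /act_series lin_sum //; apply: eq_bigr => i _; rewrite act_deg_intertwine. Qed.

End Intertwine.

Section Basic.
Variable V : lmodType k.
Implicit Types (P Q : bool -> V -> V).

Lemma eq_act_deg P Q n x : (forall a y, P a y = Q a y) -> act_deg P n x = act_deg Q n x.
Proof.
move=> PQ; apply: eq_bigr => w _; congr (_ *: _).
by elim: w => //= a w ->.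
Qed.

Lemma eq_act_series P Q x x' n : (forall a y, P a y = Q a y) -> (forall m, x m = x' m) ->
  act_series P x n = act_series Q x' n.
Proof. by move=> PQ xx; apply: eq_bigr => i _; rewrite xx (eq_act_deg _ _ PQ). Qed.

Lemma linear_foldr P w : (forall a, linear (P a)) -> linear (fun x => foldr P x w).
Proof. by move=> lP c x y; elim: w => //= a w ->; rewrite lP. Qed.

Lemma linear_act_deg P n : (forall a, linear (P a)) -> linear (act_deg P n).
Proof.
move=> lP c x y; rewrite /act_deg scaler_sumr -big_split; apply: eq_bigr => w _.
by rewrite (linear_foldr w lP) scalerDr !scalerA mulrC.
Qed.

Lemma act_series_const P (o : V) n : (forall a, linear (P a)) ->
  act_series P (const_seq o) n = act_deg P n o.
Proof.
move=> lP; rewrite /act_series big_ord_recr /= subnn big1 ?add0r // => i _.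
by rewrite -(subnSK (ltn_ord i)) /= lin0 //; apply: linear_act_deg.
Qed.

Lemma act_series_comp P Q x n : (forall a, linear (P a)) ->
  act_series P (act_series Q x) n =
  \sum_(l < n.+1) \sum_(i < l.+1) act_deg P i (act_deg Q (l - i)%N (x (n - l)%N)).
Proof.
move=> lP; under [RHS]eq_bigr => l _.
  under eq_bigr => i _ do
    rewrite -[X in (n - X)%N](@subnKC i l) -1?ltnS //.
  over.
rewrite (sum_triangle n (fun i j => act_deg P i (act_deg Q j (x (n - (i + j))%N)))).
apply: eq_bigr => i _; rewrite lin_sum //; last exact: linear_act_deg.
by apply: eq_bigr => j _; rewrite subnDA.
Qed.

End Basic.
End HomogeneousAction.

(** * Group-like series *)

Section Shuffle.
Variable k : comNzRingType.

Definition lcons (b : bool) (G : word -> k) (u : word) : k :=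
  if u is c :: u' then (c == b)%:R * G u' else 0.

Lemma sum_take a (G : word -> k) u :
  \sum_(i < (size u).+1) (take i u == a)%:R * G (drop i u) = foldr lcons G a u.
Proof.
elim: a u => [|b a IH] [|c u] /=.
- by rewrite big_ord1 mul1r.
- rewrite big_ord_recl /= mul1r big1 ?addr0 // => i _.
  by rewrite /= mul0r.
- by rewrite big_ord1 mul0r.
rewrite big_ord_recl /= mul0r add0r -IH mulr_sumr; apply: eq_bigr => i _.
by rewrite eqseq_cons mulrA -natrM mulnb.
Qed.

Lemma smul2_mono a b (G : V2hat k) u v :
  smul2 (tens (smono k a) (smono k b)) G u v =
  foldr lcons (fun u' => foldr lcons (G u') b v) a u.
Proof.
rewrite /smul2 /tens /smono -sum_take; apply: eq_bigr => i _.
rewrite -sum_take mulr_sumr; apply: eq_bigr => j _.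
by rewrite mulrA.
Qed.

Lemma smul2Dl (F F' G : V2hat k) u v :
  smul2 (fun u v => F u v + F' u v) G u v = smul2 F G u v + smul2 F' G u v.
Proof.
rewrite /smul2 -big_split; apply: eq_bigr => i _; rewrite -big_split.
by apply: eq_bigr => j _; rewrite mulrDl.
Qed.

Lemma DeltaV_word_cons a w u v :
  DeltaV_word k (a :: w) u v =
  lcons a (fun u' => DeltaV_word k w u' v) u + lcons a (DeltaV_word k w u) v.
Proof.
rewrite /= -/(DeltaV_word k w) /prim smul2Dl /sone !smul2_mono //=.
Qed.

Fixpoint unshuffle (V : nmodType) (w : word) (F : word -> word -> V) : V :=
  if w is a :: w' then
    unshuffle w' (fun u v => F (a :: u) v) + unshuffle w' (fun u v => F u (a :: v))
  else F [::] [::].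

Lemma eq_unshuffle (V : nmodType) w (F G : word -> word -> V) :
  (forall u v, F u v = G u v) -> unshuffle w F = unshuffle w G.
Proof. by elim: w F G => //= a w IH F G FG; congr (_ + _); apply: IH. Qed.

Lemma sum_lcons (V : lmodType k) a n (G : word -> k) (H : word -> V) :
  \sum_(u <- words n.+1) lcons a G u *: H u =
  \sum_(u <- words n) G u *: H (a :: u).
Proof.
rewrite big_wordsS /=.
have e b : \sum_(w <- words n) ((b == a)%:R * G w) *: H (b :: w) =
    (if b == a then \sum_(w <- words n) G w *: H (a :: w) else 0).
  case: eqP => [->|_]; first by apply: eq_bigr => w _; rewrite mul1r.
  by apply: big1 => w _; rewrite mul0r scale0r.
by rewrite !e; case: (a) => /=; rewrite /= ?addr0 ?add0r.
Qed.

(** The coproduct of a word is the sum of its splittings. *)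
Lemma unshuffleE (V : lmodType k) w (F : word -> word -> V) :
  unshuffle w F =
  \sum_(i < (size w).+1) \sum_(u <- words i) \sum_(v <- words (size w - i))
    DeltaV_word k w u v *: F u v.
Proof.
elim: w F => [|a w IH] F.
  rewrite big_ord1 !big_words0 /=; by rewrite /sone2 /tens /sone /smono eqxx mulr1 scale1r.
rewrite [LHS]/= !IH.
under [RHS]eq_bigr => i _.
  under eq_bigr => u _.
    under eq_bigr => v _ do rewrite DeltaV_word_cons scalerDl.
    rewrite big_split; over.
  rewrite big_split; over.
rewrite big_split; congr (_ + _).
  rewrite [RHS]big_ord_recl big_words0 /= [X in X + _]big1 ?add0r => [|v _]; last first.
    by rewrite scale0r.
  apply: eq_bigr => i _; rewrite /bump /= add1n subSS exchange_big /= [RHS]exchange_big /=.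
  by apply: eq_bigr => v _; rewrite sum_lcons.
rewrite [RHS]big_ord_recr /= [X in _ + X]big1 ?addr0 => [|u _]; last first.
  by rewrite subnn big_words0 /= scale0r.
apply: eq_bigr => i _; rewrite subSn; last by rewrite -ltnS.
by apply: eq_bigr => u _; rewrite sum_lcons.
Qed.

Section GroupLike.
Variable Phi : Vhat k.
Hypothesis gPhi : grouplikeV Phi.

Lemma grouplike_nil : Phi [::] = 1. Proof. by case: gPhi. Qed.

Lemma grouplike_sum u v n : n = (size u + size v)%N ->
  \sum_(w <- words n) Phi w * DeltaV_word k w u v = Phi u * Phi v.
Proof.
move=> ->; rewrite -(big_tuple_words _ xpredT (fun w => Phi w * DeltaV_word k w u v)).
by case: gPhi => /(_ u v).
Qed.

Lemma sum_unshuffle (V : lmodType k) n (F : word -> word -> V) :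
  \sum_(w <- words n) Phi w *: unshuffle w F =
  \sum_(i < n.+1) \sum_(u <- words i) \sum_(v <- words (n - i))
    (Phi u * Phi v) *: F u v.
Proof.
rewrite big_seq; under eq_bigr => w.
  rewrite mem_words => /eqP sw; rewrite unshuffleE sw scaler_sumr; over.
rewrite exchange_big /=; apply: eq_bigr => i _.
under eq_bigr => w _ do rewrite scaler_sumr.
rewrite exchange_big /= [RHS]big_seq [LHS]big_seq; apply: eq_bigr => u.
rewrite mem_words => /eqP su.
under eq_bigr => w _ do rewrite scaler_sumr.
rewrite exchange_big /= [RHS]big_seq [LHS]big_seq; apply: eq_bigr => v.
rewrite mem_words => /eqP sv.
rewrite -(@grouplike_sum u v n); last by rewrite su sv subnKC // -ltnS.
rewrite -big_seq scaler_suml; apply: eq_bigr => w _; exact: scalerA.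
Qed.

(** Expanding a word in the sums A_a + B_a amounts to splitting it, so that group-likeness of
    Phi reads Phi(A + B) = Phi(A) Phi(B) when the A_a commute with the B_b. *)
Lemma act_deg_mul (V : lmodType k) (A B : bool -> V -> V) n x :
  (forall a, linear (A a)) -> (forall a, linear (B a)) ->
  (forall a b y, A a (B b y) = B b (A a y)) ->
  act_deg Phi (fun a y => A a y + B a y) n x =
  \sum_(i < n.+1) act_deg Phi A i (act_deg Phi B (n - i) x).
Proof.
move=> lA lB AB.
have BA b u y : B b (foldr A y u) = foldr A (B b y) u.
  by elim: u => //= a u <-; rewrite AB.
have lun w (f : V -> V) (F : word -> word -> V) : linear f ->
    f (unshuffle w F) = unshuffle w (fun u v => f (F u v)).
  by move=> lf; elim: w F => //= a w IH F; rewrite linD // !IH.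
rewrite /act_deg; transitivity (\sum_(w <- words n) Phi w *:
    unshuffle w (fun u v => foldr A (foldr B x v) u)).
  apply: eq_bigr => w _; congr (_ *: _); elim: w => //= a w ->.
  rewrite (lun _ (A a)) // (lun _ (B a)) //; congr (_ + _); apply: eq_unshuffle => u v.
  by rewrite BA.
rewrite sum_unshuffle; apply: eq_bigr => i _; apply: eq_bigr => u _.
rewrite (lin_sum (linear_foldr u lA)) scaler_sumr; apply: eq_bigr => v _.
by rewrite (linZ (linear_foldr u lA)) scalerA.
Qed.

Lemma act_deg_single (V : lmodType k) (P : bool -> V -> V) b n x :
  (forall a, linear (P a)) -> (forall y, P (~~ b) y = 0) ->
  act_deg Phi P n x = Phi (nseq n b) *: iter n (P b) x.
Proof.
move=> lP P0; rewrite /act_deg.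
have H (c : word -> k) : \sum_(w <- words n) c w *: foldr P x w =
    c (nseq n b) *: iter n (P b) x; last exact: H.
elim: n c => [|n IH] c; first by rewrite big_words0.
rewrite big_wordsS.
have e1 a : \sum_(w <- words n) c (a :: w) *: foldr P x (a :: w) =
    P a (\sum_(w <- words n) c (a :: w) *: foldr P x w).
  by rewrite lin_sum //; apply: eq_bigr => w _; rewrite linZ.
by rewrite !e1 !IH; case: b P0 {IH} => P0; rewrite !P0 ?add0r ?addr0 linZ.
Qed.

End GroupLike.
End Shuffle.

Section Powers.
Variables (k : comAlgType rat) (Phi : Vhat k).
Hypothesis gPhi : grouplikeV Phi.

Lemma mulrn_eq0_rat (x : k) n : x *+ n.+1 = 0 -> x = 0.
Proof.
rewrite -scaler_nat => /eqP; rewrite scaler_eq0 Num.Theory.pnatr_eq0 /= => /eqP //.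
Qed.

(** By [act_deg_mul] for the sum of a single operator with itself, the coefficient c of degree n
    satisfies 2^n c = 2 c + (terms that vanish by induction). *)
Lemma grouplike_power b n : Phi [:: b] = 0 -> Phi (nseq n.+1 b) = 0.
Proof.
move=> Phib; elim/ltn_ind: n => -[|n] IH //.
(* On the module k, let the letter b act by 1 and the other letter by 0. *)
pose A (c : bool) (y : k^o) : k^o := if c == b then y else 0.
have lA c : linear (A c) by rewrite /A; case: eqP => _ a x y //; rewrite scaler0 addr0.
have AA c d y : A c (A d y) = A d (A c y) by rewrite /A; do 2 case: eqP.
have := act_deg_mul gPhi n.+2 (1 : k^o) lA lA AA.
have l2 c : linear (fun y => A c y + A c y) by move=> a x y; rewrite lA scalerDr addrACA.
have A0 y : A (~~ b) y = 0 by rewrite /A; case: (b).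
have A1 m y : iter m (A b) y = y by rewrite /A eqxx; elim: m.
rewrite (act_deg_single _ (b := b)) //; last by move=> y; rewrite A0 addr0.
have -> m : iter m (fun y => A b y + A b y) 1 = (2 ^ m)%:R.
  by elim: m => //= m ->; rewrite /A eqxx -natrD addnn -mul2n expnS.
rewrite big_ord_recl big_ord_recr /= big1 ?add0r => [|i _]; last first.
  rewrite (act_deg_single _ (b := b)) // A1 /bump add1n.
  by rewrite (IH i) ?scale0r // ltnS ltnW.
rewrite subn0 /bump add1n subnn !(act_deg_single _ (b := b)) // !A1 /= grouplike_nil //.
set c := Phi _; rewrite scale1r => e.
have {}e : c *+ 2 ^ n.+2 = c *+ 2 by move: e; rewrite /GRing.scale /= !mulr1 mulr_natr mulr2n.
have {e}: c *+ (2 ^ n.+2 - 2) = 0.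
  by rewrite mulrnBr ?e ?subrr // expnS leq_pmulr // expn_gt0.
rewrite !expnS; case: (2 ^ n)%N (expn_gt0 2 n) => // m _.
have -> : (2 * (2 * m.+1) - 2 = (4 * m).+2)%N by lia.
exact: mulrn_eq0_rat.
Qed.

End Powers.

(** * Modules over the enveloping algebra of p_5 *)

(** Ten operators subject to the defining relations of p_5 make V a module over U(p_5); only
    the relations between generators have to be checked, as [p5_eq] and [u_eq] are the
    congruences that they generate. *)
Section Representation.
Variables (k : comNzRingType) (V : lmodType k) (G : 'I_5 -> 'I_5 -> V -> V).
Hypothesis lG : forall i j, linear (G i j).
Hypothesis GC : forall i j, i != j -> forall x, G j i x = G i j x.
Hypothesis Gcomm : forall i j l m, uniq [:: i; j; l; m] ->
  forall x, G i j (G l m x) = G l m (G i j x).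
Hypothesis Gsum : forall i x, \sum_(j | j != i) G i j x = 0.

Fixpoint leval (t : lterm k) (v : V) : V :=
  match t with
  | LGen p => G (val p).1 (val p).2 v
  | LZero => 0
  | LAdd x z => leval x v + leval z v
  | LScale c x => c *: leval x v
  | LBr x z => leval x (leval z v) - leval z (leval x v)
  end.

Lemma leval_linear t : linear (leval t).
Proof.
elim: t => [p||x lx z lz|c x lx|x lx z lz] a u v /=; rewrite ?lG //.
- by rewrite scaler0 addr0.
- by rewrite lx lz scalerDr addrACA.
- by rewrite lx scalerDr !scalerA mulrC.
- by rewrite lx lz lx lz scalerBr opprD addrACA.
Qed.

Lemma leval_e i j v : leval (p5_e i j) v = if i != j then G i j v else 0.
Proof. by rewrite /p5_e; case: insubP => [p /= -> ->|/negbTE /= ->]. Qed.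

Lemma p5_eq_leval t t' : p5_eq t t' -> forall v, leval t v = leval t' v.
Proof.
have lin := leval_linear.
elim=> {t t'} /=.
- by [].
- by move=> x x' _ IH v; rewrite IH.
- by move=> x x' x'' _ IH _ IH' v; rewrite IH.
- by move=> x x' z z' _ IH _ IH' v; rewrite IH IH'.
- by move=> c x x' _ IH v; rewrite IH.
- by move=> x x' z z' _ IH _ IH' v; rewrite !IH !IH'.
- by move=> x z t v; rewrite addrA.
- by move=> x z v; rewrite addrC.
- by move=> x v; rewrite add0r.
- by move=> x v; rewrite scaleN1r addNr.
- by move=> a b x v; rewrite scalerA.
- by move=> x v; rewrite scale1r.
- by move=> a x z v; rewrite scalerDr.
- by move=> a b x v; rewrite scalerDl.
- by move=> x z t v; rewrite (linD (lin t)) opprD addrACA.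
- by move=> x z t v; rewrite (linD (lin x)) opprD addrACA.
- by move=> a x z v; rewrite (linZ (lin z)) scalerBr.
- by move=> a x z v; rewrite (linZ (lin x)) scalerBr.
- by move=> x v; rewrite subrr.
- move=> x z t v; rewrite !(linB (lin _)) !opprB.
  set a := leval x (leval z (leval t v)); set b := leval x (leval t (leval z v)).
  set c := leval z (leval t (leval x v)); set d := leval t (leval z (leval x v)).
  set e := leval z (leval x (leval t v)); set f := leval t (leval x (leval z v)).
  (* the twelve terms of the Jacobi identity cancel in pairs *)
  rewrite [LHS](AC ((2*2)*((2*2)*(2*2))) ((1*12)*(2*7)*(3*10)*(4*5)*(6*11)*(8*9)))/=.
  by rewrite !subrr !addNr !addr0.
- by move=> i j ij v; rewrite !leval_e eq_sym ij; apply: GC.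
- move=> i j l m u v; rewrite !leval_e.
  have /and3P[] := u; rewrite !inE !negb_or => /and3P[-> _ _] _ /andP[-> _].
  by rewrite Gcomm // subrr.
- move=> i v; rewrite -[RHS](Gsum i v).
  transitivity (\sum_(j <- [seq j <- enum 'I_5 | j != i]) leval (p5_e i j) v).
    by elim: [seq _ <- _ | _] => [|j s IH] /=; rewrite ?big_nil // big_cons IH.
  rewrite big_filter big_enum_cond; apply: eq_bigr => j ji.
  by move: ji; rewrite leval_e eq_sym => /andP[_ ->].
Qed.

Fixpoint ueval (t : uterm k) (v : V) : V :=
  match t with
  | UIn x => leval x v
  | UConst c => c *: v
  | UAdd x z => ueval x v + ueval z v
  | UMul x z => ueval x (ueval z v)
  end.

Lemma ueval_linear t : linear (ueval t).
Proof.
elim: t => [x|c|x lx z lz|x lx z lz] a u v /=; first exact: leval_linear.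
- by rewrite scalerDr !scalerA mulrC.
- by rewrite lx lz scalerDr addrACA.
- by rewrite lz lx.
Qed.

Lemma u_eq_ueval t t' : u_eq t t' -> forall v, ueval t v = ueval t' v.
Proof.
have lin := ueval_linear.
elim=> {t t'} /=.
- by [].
- by move=> x x' _ IH v; rewrite IH.
- by move=> x x' x'' _ IH _ IH' v; rewrite IH.
- by move=> x x' z z' _ IH _ IH' v; rewrite IH IH'.
- by move=> x x' z z' _ IH _ IH' v; rewrite IH IH'.
- by move=> x z t v; rewrite addrA.
- by move=> x z v; rewrite addrC.
- by move=> x v; rewrite scale0r add0r.
- by move=> x v; rewrite scaleN1r addNr scale0r.
- by [].
- by move=> x v; rewrite scale1r.
- by [].
- by move=> x z t v; rewrite (linD (lin x)).
- by move=> a b v; rewrite scalerDl.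
- by move=> a b v; rewrite scalerA.
- by move=> a x v; rewrite (linZ (lin x)).
- by move=> x x' /p5_eq_leval.
- by [].
- by [].
- by move=> x z v; rewrite scaleN1r.
Qed.

Definition uact (a : Up5 k) (v : V) : V := ueval (repr a) v.

Lemma uact_up5 t v : uact (up5 t) v = ueval t v.
Proof. exact/u_eq_ueval/repr_up5. Qed.

Lemma uactD a b v : uact (a + b) v = uact a v + uact b v.
Proof.
by case: (up5_surj a) (up5_surj b) => x -> [z ->]; rewrite -up5D !uact_up5.
Qed.

Lemma uactM a b v : uact (a * b) v = uact a (uact b v).
Proof.
by case: (up5_surj a) (up5_surj b) => x -> [z ->]; rewrite -up5M !uact_up5.
Qed.

Lemma uact1 v : uact 1 v = v.
Proof. by rewrite -[1]/(up5 (UConst 1)) uact_up5 /= scale1r. Qed.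

Lemma uact0 v : uact 0 v = 0.
Proof. by rewrite -[0]/(up5 (UConst 0)) uact_up5 /= scale0r. Qed.

Lemma uactZ c a v : uact (c *: a) v = c *: uact a v.
Proof. by rewrite -mulr_algl uactM -up5C uact_up5. Qed.

Lemma uact_sum I (r : seq I) (P : pred I) (F : I -> Up5 k) v :
  uact (\sum_(i <- r | P i) F i) v = \sum_(i <- r | P i) uact (F i) v.
Proof.
elim: r => [|i r IH]; rewrite ?big_nil ?uact0 // !big_cons.
by case: (P i); rewrite // uactD IH.
Qed.

Lemma uact_prod (P : bool -> Up5 k) w v :
  uact (\prod_(a <- w) P a) v = foldr (fun a => uact (P a)) v w.
Proof.
by elim: w => [|a w IH]; rewrite ?big_nil ?uact1 // big_cons uactM IH.
Qed.

Lemma uact_subst (Phi : Vhat k) I J K n v :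
  uact (subst Phi I J K n) v =
  act_deg Phi (fun a => uact (if a then e_ k J K else e_ k I J)) n v.
Proof.
rewrite /subst uact_sum (big_tuple_words _ xpredT (fun w => uact (Phi w *:
  \prod_(a <- w) (if a then e_ k J K else e_ k I J)) v)).
apply: eq_bigr => w _; rewrite uactZ.
by rewrite (uact_prod (fun a => if a then e_ k J K else e_ k I J)).
Qed.

Lemma uact_cmul (x z : Up5hat k) n v :
  uact (cmul x z n) v = \sum_(i < n.+1) uact (x i) (uact (z (n - i)%N) v).
Proof. by rewrite uact_sum; apply: eq_bigr => i _; rewrite uactM. Qed.

Lemma uact_e I J v :
  uact (e_ k I J) v =
  \sum_(i <- I) \sum_(j <- J)
    (if label i != label j then G (label i) (label j) v else 0).
Proof.
rewrite /e_ uact_sum; apply: eq_bigr => i _; rewrite uact_sum.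
by apply: eq_bigr => j _; rewrite uact_up5 /= leval_e.
Qed.

End Representation.

(** * Modules of functions *)

(** The modules in use consist of functions with values in k, so that an identity in them is
    an identity in the commutative ring k at every point, within reach of [ring]. *)
Definition fn (k T : Type) := T -> k.

Section Functions.
Variables (k : comNzRingType) (T : Type).
Implicit Types f g : fn k T.

Lemma fnP f g : (forall t, f t = g t) -> f = g.
Proof. by move=> fg; apply: funext. Qed.

HB.instance Definition _ := gen_eqMixin (fn k T).
HB.instance Definition _ := gen_choiceMixin (fn k T).

Let addf f g : fn k T := fun t => f t + g t.
Let oppf f : fn k T := fun t => - f t.
Let zerof : fn k T := fun=> 0.
Let scalef c f : fn k T := fun t => c * f t.

Let addfA : associative addf. Proof. by move=> f g h; apply: fnP => t; exact: addrA. Qed.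
Let addfC : commutative addf. Proof. by move=> f g; apply: fnP => t; exact: addrC. Qed.
Let add0f : left_id zerof addf. Proof. by move=> f; apply: fnP => t; exact: add0r. Qed.
Let addNf : left_inverse zerof oppf addf.
Proof. by move=> f; apply: fnP => t; exact: addNr. Qed.

HB.instance Definition _ := GRing.isZmodule.Build (fn k T) addfA addfC add0f addNf.

Let scalefA c d f : scalef c (scalef d f) = scalef (c * d) f.
Proof. by apply: fnP => t; exact: mulrA. Qed.
Let scale1f : left_id 1 scalef. Proof. by move=> f; apply: fnP => t; exact: mul1r. Qed.
Let scalefDr : right_distributive scalef +%R.
Proof. by move=> c f g; apply: fnP => t; exact: mulrDr. Qed.
Let scalefDl f : {morph scalef^~ f : c d / c + d}.
Proof. by move=> c d; apply: fnP => t; exact: mulrDl. Qed.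

HB.instance Definition _ :=
  GRing.Zmodule_isLmodule.Build k (fn k T) scalefA scale1f scalefDr scalefDl.

Lemma fnD f g t : (f + g) t = f t + g t. Proof. by []. Qed.
Lemma fnN f t : (- f) t = - f t. Proof. by []. Qed.
Lemma fn0 t : (0 : fn k T) t = 0. Proof. by []. Qed.
Lemma fnZ c f t : (c *: f) t = c * f t. Proof. by []. Qed.
Lemma fn_sum I (r : seq I) (P : pred I) (F : I -> fn k T) t :
  (\sum_(i <- r | P i) F i) t = \sum_(i <- r | P i) F i t.
Proof. by elim/big_rec2: _ => // i y1 y2 _ <-. Qed.

End Functions.

Section Pairs.
Variables (k : comNzRingType) (A B : lmodType k).
Lemma pairD (a b : A) (c d : B) : (a, c) + (b, d) = (a + b, c + d). Proof. by []. Qed.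
Lemma pairN (a : A) (c : B) : - (a, c) = (- a, - c). Proof. by []. Qed.
Lemma pairZ x (a : A) (c : B) : x *: (a, c) = (x *: a, x *: c). Proof. by []. Qed.
Lemma pair0 : (0 : A * B) = (0, 0). Proof. by []. Qed.
End Pairs.

(** * A representation of p_5 on triples *)

Section EdgeTable.
Variables (V : nmodType) (o12 o13 o14 o15 o23 o24 o25 o34 o35 o45 : V -> V).

(** The indices 0, ..., 4 of the type 'I_5 stand for the labels 1, ..., 5. *)
Definition edge_op (i j : nat) (x : V) : V :=
  match i, j with
  | 0, 1 | 1, 0 => o12 x
  | 0, 2 | 2, 0 => o13 x
  | 0, 3 | 3, 0 => o14 x
  | 0, 4 | 4, 0 => o15 x
  | 1, 2 | 2, 1 => o23 x
  | 1, 3 | 3, 1 => o24 x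
  | 1, 4 | 4, 1 => o25 x
  | 2, 3 | 3, 2 => o34 x
  | 2, 4 | 4, 2 => o35 x
  | 3, 4 | 4, 3 => o45 x
  | _, _ => 0
  end.

Lemma edge_opC (i j : 'I_5) x : edge_op j i x = edge_op i j x.
Proof. by case: i j => [[|[|[|[|[|i]]]]] //= Hi] [[|[|[|[|[|j]]]]] //= Hj]. Qed.

Lemma edge_op_comm :
  (forall x, o12 (o34 x) = o34 (o12 x)) ->
  (forall x, o12 (o35 x) = o35 (o12 x)) ->
  (forall x, o12 (o45 x) = o45 (o12 x)) ->
  (forall x, o13 (o24 x) = o24 (o13 x)) ->
  (forall x, o13 (o25 x) = o25 (o13 x)) ->
  (forall x, o13 (o45 x) = o45 (o13 x)) ->
  (forall x, o14 (o23 x) = o23 (o14 x)) ->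
  (forall x, o14 (o25 x) = o25 (o14 x)) ->
  (forall x, o14 (o35 x) = o35 (o14 x)) ->
  (forall x, o15 (o23 x) = o23 (o15 x)) ->
  (forall x, o15 (o24 x) = o24 (o15 x)) ->
  (forall x, o15 (o34 x) = o34 (o15 x)) ->
  (forall x, o23 (o45 x) = o45 (o23 x)) ->
  (forall x, o24 (o35 x) = o35 (o24 x)) ->
  (forall x, o25 (o34 x) = o34 (o25 x)) ->
  forall i j l m : 'I_5, uniq [:: i; j; l; m] ->
  forall x, edge_op i j (edge_op l m x) = edge_op l m (edge_op i j x).
Proof.
move=> c12_34 c12_35 c12_45 c13_24 c13_25 c13_45 c14_23 c14_25 c14_35 c15_23 c15_24 c15_34
  c23_45 c24_35 c25_34 i j l m.
rewrite /= !inE -!val_eqE.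
case: i => [[|[|[|[|[|i]]]]] //= _]; case: j => [[|[|[|[|[|j]]]]] //= _] //=;
case: l => [[|[|[|[|[|l]]]]] //= _] //=; case: m => [[|[|[|[|[|m]]]]] //= _] //= _ x;
  by rewrite ?(c12_34, c12_35, c12_45, c13_24, c13_25, c13_45, c14_23, c14_25, c14_35, c15_23,
    c15_24, c15_34, c23_45, c24_35, c25_34).
Qed.

End EdgeTable.

Section Triples.
Variables (k : comNzRingType) (T : Type).
Notation L := (fn k T).
Notation L3 := (L * L * L)%type.
Variables (E F : bool -> L -> L).
Hypotheses (lE : forall a, linear (E a)) (lF : forall a, linear (F a)).
Hypothesis EF : forall a b x, E a (F b x) = F b (E a x).

(** The residues of the system satisfied by (q, p, r): along x = 0 (op12), y = 0 (op45),
    x = 1 (op23), y = 1 (op34) and xy = 1 (op24). *)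
Definition op12 (x : L3) : L3 := let: (q, p, r) := x in
  (E false q - E true r, E false p - E true r, F false r).
Definition op45 (x : L3) : L3 := let: (q, p, r) := x in
  (F false q, E false p - E true r, F false r).
Definition op23 (x : L3) : L3 := let: (q, p, r) := x in (E true (q + r), 0, 0).
Definition op34 (x : L3) : L3 := let: (q, p, r) := x in (F true (q - p), 0, 0).
Definition op24 (x : L3) : L3 := let: (q, p, r) := x in
  (0, E true (p + r), F true (p + r)).

Let linEF := (fun a => linD (lE a), fun a => linD (lF a), fun a => linN (lE a),
  fun a => linN (lF a), fun a => lin0 (lE a), fun a => lin0 (lF a)).
Let linEFZ := (fun a => linZ (lE a), fun a => linZ (lF a)).

Ltac op_norm := rewrite /op12 /op45 /op23 /op34 /op24 /= ?(pairD, pairN, pairZ, pair0) /=.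
Ltac fn_ring := rewrite ?linEF ?linEFZ ?EF; apply: fnP => t;
  rewrite ?(fnD, fnN, fn0, fnZ); ring.
Ltac op_linear_tac := move=> c [[q p] r] [[q' p'] r']; op_norm; congr (_, _, _); fn_ring.

Lemma op12_linear : linear op12. Proof. op_linear_tac. Qed.
Lemma op45_linear : linear op45. Proof. op_linear_tac. Qed.
Lemma op23_linear : linear op23. Proof. op_linear_tac. Qed.
Lemma op34_linear : linear op34. Proof. op_linear_tac. Qed.
Lemma op24_linear : linear op24. Proof. op_linear_tac. Qed.

(** The relations sum_j e_ij = 0 determine the other generators from the five above. *)
Definition op13 x := op45 x - op12 x - op23 x.
Definition op14 x := - op24 x - op45 x - op34 x.
Definition op15 x := op23 x + op34 x + op24 x.
Definition op25 x := - op24 x - op12 x - op23 x.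
Definition op35 x := op12 x - op45 x - op34 x.

Definition op_ij (i j : 'I_5) :=
  edge_op op12 op13 op14 op15 op23 op24 op25 op34 op35 op45 i j.

Lemma op_ij_linear i j : linear (op_ij i j).
Proof.
have l0 : linear (fun _ : L3 => 0 : L3) by move=> c x y; rewrite scaler0 addr0.
case: i j => [[|[|[|[|[|i]]]]] //= Hi] [[|[|[|[|[|j]]]]] //= Hj] //;
  by do ?[exact: l0 | exact: op12_linear | exact: op45_linear |
    exact: op23_linear | exact: op34_linear | exact: op24_linear | apply: lin_add | apply: lin_opp].
Qed.

Lemma op_ij_comm i j l m : uniq [:: i; j; l; m] ->
  forall x, op_ij i j (op_ij l m x) = op_ij l m (op_ij i j x).
Proof.
by apply: edge_op_comm => -[[q p] r]; rewrite /op13 /op14 /op15 /op25 /op35; op_norm;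
  congr (_, _, _); fn_ring.
Qed.

Lemma op_ij_sum i x : \sum_(j | j != i) op_ij i j x = 0.
Proof.
rewrite big_mkcond !big_ord_recl big_ord0.
case: i x => [[|[|[|[|[|i]]]]] //= Hi] [[q p] r].
all: rewrite /op_ij /= /op13 /op14 /op15 /op25 /op35; op_norm; congr (_, _, _); fn_ring.
Qed.

End Triples.

(** * The pentagon in this representation *)

Section MainIdentity.
Variables (k : comNzRingType) (Phi : Vhat k).
Hypothesis gPhi : grouplikeV Phi.
Hypothesis Phi_pow : forall b n, Phi (nseq n.+1 b) = 0.

Lemma act_deg_kill (V : lmodType k) (P : bool -> V -> V) x n :
  (forall a, linear (P a)) -> (forall a, P a x = 0) -> act_deg Phi P n x = const_seq x n.
Proof.
move=> lP Px; case: n => [|n]; first by rewrite /act_deg big_words0 grouplike_nil // scale1r.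
rewrite /act_deg big_words_rcons.
by rewrite !big1 ?addr0 // => w _; rewrite foldr_rcons Px (lin0 (linear_foldr w lP)) scaler0.
Qed.

Lemma act_deg_single_gt0 (V : lmodType k) (P : bool -> V -> V) b n x :
  (forall a, linear (P a)) -> (forall y, P (~~ b) y = 0) ->
  act_deg Phi P n x = const_seq x n.
Proof.
move=> lP P0; rewrite (act_deg_single Phi (b := b)) //.
by case: n => [|n] /=; rewrite ?grouplike_nil ?scale1r // Phi_pow scale0r.
Qed.

Lemma act_deg_const0 (V : lmodType k) (P : bool -> V -> V) x n m :
  (forall a, linear (P a)) ->
  act_deg Phi P n (const_seq x m) = if m == 0%N then act_deg Phi P n x else 0.
Proof. by move=> lP; case: m => //= m; rewrite (lin0 (linear_act_deg Phi n lP)). Qed.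

(** Adding to one of the two operators an operator that commutes with both has no effect:
    the additional factor is Phi(B, 0) or Phi(0, B), which is 1 since the coefficients of
    the powers of a letter vanish. *)
Lemma act_deg_add_single (V : lmodType k) (A B : bool -> V -> V) b n x :
  (forall a, linear (A a)) -> (forall a, linear (B a)) ->
  (forall a c y, A a (B c y) = B c (A a y)) -> (forall y, B (~~ b) y = 0) ->
  act_deg Phi (fun a y => A a y + B a y) n x = act_deg Phi A n x.
Proof.
move=> lA lB AB B0; rewrite act_deg_mul // big_ord_recr /= subnn big1 => [|i _].
  by rewrite add0r (@act_deg_single_gt0 _ B b).
rewrite (@act_deg_single_gt0 _ B b) // act_deg_const0 //.
by rewrite subn_eq0 leqNgt ltn_ord.
Qed.

(** Phi becomes 1 on commuting operators A and B, as Phi(A, 0) Phi(0, B). *)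
Lemma act_deg_comm (V : lmodType k) (A B : V -> V) n x :
  linear A -> linear B -> (forall y, A (B y) = B (A y)) ->
  act_deg Phi (fun a => if a then B else A) n x = const_seq x n.
Proof.
move=> lA lB AB; pose A' (a : bool) y := if a then 0 else A y.
pose B' (a : bool) y := if a then B y else 0.
have l0 : linear (fun _ : V => 0 : V) by move=> c y z; rewrite scaler0 addr0.
have lA' a : linear (A' a) by case: a.
have lB' a : linear (B' a) by case: a.
rewrite -(@act_deg_single_gt0 _ A' false) // -(@act_deg_add_single _ A' B' true) //.
- by apply: eq_act_deg => -[] y; rewrite /A' /B' ?add0r ?addr0.
- by case=> -[] y; rewrite /A' /B' ?lin0.
Qed.

Section Pentagon.
Variable T : Type.
Notation L := (fn k T).
Variables (E F : bool -> L -> L).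
Hypotheses (lE : forall a, linear (E a)) (lF : forall a, linear (F a)).
Hypothesis EF : forall a b x, E a (F b x) = F b (E a x).

Local Notation L3 := (L * L * L)%type.
Local Notation e12 := (op12 E F).
Local Notation e45 := (op45 E F).
Local Notation e23 := (op23 E).
Local Notation e34 := (op34 F).
Local Notation e24 := (op24 E F).
Local Notation op := (op_ij E F).
Local Notation act := (uact op).

Definition ops234 a : L3 -> L3 := if a then e34 else e23.
Definition ops1_23_4 a : L3 -> L3 :=
  if a then fun x => e24 x + e34 x else fun x => e12 x + op13 E F x.
Definition ops123 a : L3 -> L3 := if a then e23 else e12.
Definition ops12_34 a : L3 -> L3 := if a then fun x => e23 x + e24 x else e12.
Definition ops12_3_4 a : L3 -> L3 := if a then e34 else fun x => op13 E F x + e23 x.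

Let le12 := op12_linear lE lF.
Let le45 := op45_linear lE lF.
Let le23 := op23_linear lE.
Let le34 := op34_linear lF.
Let le24 := op24_linear lE lF.

Lemma op13_linear : linear (op13 E F).
Proof. by do ?[apply: lin_add | apply: lin_opp]. Qed.

Lemma ops_linear a : [/\ linear (ops234 a), linear (ops1_23_4 a), linear (ops123 a),
  linear (ops12_34 a) & linear (ops12_3_4 a)].
Proof.
have l13 := op13_linear.
by case: a; split => //; apply: lin_add.
Qed.

Hypothesis pentPhi : pentagon Phi.

Lemma pentagon_act_series w n :
  act_series Phi ops234 (act_series Phi ops1_23_4 (act_series Phi ops123 (const_seq w))) n =
  act_series Phi ops12_34 (act_series Phi ops12_3_4 (const_seq w)) n.
Proof.
have l1 a : linear (ops234 a) by case: (ops_linear a).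
have l2 a : linear (ops1_23_4 a) by case: (ops_linear a).
have l3 a : linear (ops123 a) by case: (ops_linear a).
have l4 a : linear (ops12_34 a) by case: (ops_linear a).
have l5 a : linear (ops12_3_4 a) by case: (ops_linear a).
have lop := op_ij_linear lE lF.
have opC i j (ij : i != j) x : op j i x = op i j x by apply: edge_opC.
have opcomm := op_ij_comm lE lF EF.
have opsum := op_ij_sum lE lF.
have actE I J x : act (e_ k I J) x = _ := uact_e lop opC opcomm opsum I J x.
have actS I J K m x : act (subst Phi I J K m) x = _ :=
  uact_subst lop opC opcomm opsum Phi I J K m x.
have actM a b m x : act (cmul a b m) x = _ := uact_cmul lop opC opcomm opsum a b m x.
have := congr1 (act^~ w) (pentPhi n); rewrite /= !actM => pent.
(* [label] has values in an ordinal type: both facts reduce to its numerical value. *)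
have lbl i j : (0 < i < 6)%N -> (0 < j < 6)%N -> (label i != label j) = (i != j).
  by case: i j => [|i] [|j] //= hi hj; rewrite -val_eqE /= !inordK.
have e_op i j x : (0 < i < 6)%N -> (0 < j < 6)%N -> op (label i) (label j) x =
    edge_op e12 (op13 E F) (op14 E F) (op15 E F) e23 e24 (op25 E F) e34 (op35 E F) e45 i.-1 j.-1 x.
  by case: i j => [|i] [|j] //= hi hj; rewrite /op_ij !inordK.
have h234 m x : act (subst Phi [:: 2]%N [:: 3]%N [:: 4]%N m) x = act_deg Phi ops234 m x.
  by rewrite actS; apply: eq_act_deg => -[] y /=; rewrite actE !big_seq1 lbl // e_op.
have h1_23_4 m x : act (subst Phi [:: 1]%N [:: 2; 3]%N [:: 4]%N m) x = act_deg Phi ops1_23_4 m x.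
  rewrite actS; apply: eq_act_deg => -[] y /=; rewrite actE ?big_seq1 ?big_cons ?big_nil ?addr0;
    by rewrite !lbl // !e_op.
have h123 m x : act (subst Phi [:: 1]%N [:: 2]%N [:: 3]%N m) x = act_deg Phi ops123 m x.
  by rewrite actS; apply: eq_act_deg => -[] y /=; rewrite actE !big_seq1 lbl // e_op.
have h12_34 m x : act (subst Phi [:: 1]%N [:: 2]%N [:: 3; 4]%N m) x = act_deg Phi ops12_34 m x.
  rewrite actS; apply: eq_act_deg => -[] y /=; rewrite actE ?big_seq1 ?big_cons ?big_nil ?addr0;
    by rewrite !lbl // !e_op.
have h12_3_4 m x : act (subst Phi [:: 1; 2]%N [:: 3]%N [:: 4]%N m) x = act_deg Phi ops12_3_4 m x.
  rewrite actS; apply: eq_act_deg => -[] y /=; rewrite actE ?big_seq1 ?big_cons ?big_nil ?addr0;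
    by rewrite ?big_seq1 !lbl // !e_op.
rewrite act_series_comp //; transitivity (act (cmul (subst Phi [:: 1]%N [:: 2]%N [:: 3; 4]%N)
    (subst Phi [:: 1; 2]%N [:: 3]%N [:: 4]%N) n) w); last first.
  by rewrite actM; apply: eq_bigr => i _; rewrite h12_34 h12_3_4 act_series_const.
rewrite actM -pent; apply: eq_bigr => l _; rewrite actM; apply: eq_bigr => i _.
by rewrite h123 h1_23_4 h234 act_series_const.
Qed.

Variable o : L.
Hypotheses (Eo : E false o = 0) (Fo : F false o = 0).

(** The matrices by which e_0 and e_1 act on (p, r), where the connection only involves xy.
    As opM true has rank one, with p + r on the right, a product of blocks e_0^(n-1) e_1 becomes
    a product of values of one function of n, which turns out to be the harmonic coproduct of
    - y_n: see [harmonic_block]. *)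
Definition opM (a : bool) (x : L * L) : L * L := let: (p, r) := x in
  if a then (E true (p + r), F true (p + r)) else (E false p - E true r, F false r).
(** The component of degree n of the harmonic coproduct of Phi, applied to o. *)
Definition harmonic_side (n : nat) : L := let: (p, r) := act_deg Phi opM n (o, 0) in p + r.

(** The component of degree n of Phi(F) Phi(E) o, that is of Phi (x) Phi in the tensor
    square of M. *)
Definition shuffle_side (n : nat) : L := \sum_(i < n.+1) act_deg Phi F i (act_deg Phi E (n - i) o).

(** The part of degree n + 1 of C(E_1, F_1): it comes from the words of Phi that end with e_1,
    read in the letters E_1, F_1. *)
Definition correction (n : nat) (x : L) : L :=
  \sum_(w <- words n) Phi (rcons w true) *:
    foldr (fun a : bool => if a then F true else E true) (F true x) w.

Let linEF := (fun a => linD (lE a), fun a => linD (lF a), fun a => linN (lE a),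
  fun a => linN (lF a), fun a => lin0 (lE a), fun a => lin0 (lF a)).
Let linEFZ := (fun a => linZ (lE a), fun a => linZ (lF a)).
Ltac op_norm := rewrite /op12 /op45 /op23 /op34 /op24 /op13 /= ?(pairD, pairN, pairZ, pair0) /=.
Ltac fn_ring := rewrite ?linEF ?linEFZ ?EF ?Eo ?Fo; apply: fnP => t;
  rewrite ?(fnD, fnN, fn0, fnZ); ring.

Let w0 : L3 := (o, o, 0).
Let sum_qr (x : L3) : L := x.1.1 + x.2.
Let sum_pr (x : L3) : L := x.1.2 + x.2.

Let sum_qr_linear : linear sum_qr.
Proof. by move=> c [[q p] r] [[q' p'] r']; rewrite /sum_qr /=; fn_ring. Qed.
Let sum_pr_linear : linear sum_pr.
Proof. by move=> c [[q p] r] [[q' p'] r']; rewrite /sum_pr /=; fn_ring. Qed.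

Lemma opM_linear a : linear (opM a).
Proof.
by case: a => c [p r] [p' r']; rewrite /opM /= ?(pairD, pairN, pairZ) /=;
  congr (_, _); fn_ring.
Qed.

(* Edge by edge: w0 is the solution at (x, y) = (0, 0), and it is constant on x = 0. *)
Let step12_3_4 n : act_series Phi ops12_3_4 (const_seq w0) n = const_seq w0 n.
Proof.
have l a : linear (ops12_3_4 a) by case: (ops_linear a).
rewrite act_series_const // act_deg_kill // => -[]; rewrite /w0; op_norm; congr (_, _, _); fn_ring.
Qed.

(* On y = 1 the subspace q = p is stable, and (p, r) evolves by the matrices opM. *)
Let step12_34 n : act_series Phi ops12_34 (const_seq w0) n =
  let: (p, r) := act_deg Phi opM n (o, 0) in (p, p, r).
Proof.
pose iota (x : L * L) : L3 := (x.1, x.1, x.2).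
have li : linear iota by move=> c [p r] [p' r']; rewrite /iota; op_norm.
have l a : linear (ops12_34 a) by case: (ops_linear a).
rewrite act_series_const // -[w0]/(iota (o, 0)) -(@act_deg_intertwine _ _ _ _ iota opM) //.
  by case: (act_deg _ _ _ _).
by case=> -[p r]; rewrite /iota; op_norm; congr (_, _, _); fn_ring.
Qed.

(* On y = 0 the component r stays 0, and q evolves by left multiplication by e_0, e_1. *)
Let step123 n : sum_qr (act_series Phi ops123 (const_seq w0) n) = act_deg Phi E n o.
Proof.
have l a : linear (ops123 a) by case: (ops_linear a).
pose N (a : bool) (x : L * L) : L * L := if a then (E true x.1, 0) else (E false x.1, E false x.2).
pose kap (x : L * L) : L3 := (x.1, x.2, 0).
have lk : linear kap by move=> c [p r] [p' r']; rewrite /kap; op_norm; congr (_, _, _); fn_ring.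
have lfst : linear (fun x : L * L => x.1) by move=> c [p r] [p' r'].
rewrite act_series_const // -[w0]/(kap (o, o)) -(@act_deg_intertwine _ _ _ _ kap N) //; last first.
  by case=> -[p r]; rewrite /kap; op_norm; congr (_, _, _); fn_ring.
rewrite {1}/sum_qr /kap /= addr0 (@act_deg_intertwine _ _ _ _ (fun x : L * L => x.1) N E) //.
by case=> -[p r].
Qed.

(* On x = 1 the combination q + r evolves by itself, by F_0 - E_1 and F_1; here E_1 can be
   dropped since it commutes with F_0 and F_1. *)
Let step1_23_4 n : sum_qr (act_series Phi ops1_23_4 (act_series Phi ops123 (const_seq w0)) n) =
  shuffle_side n.
Proof.
pose S (a : bool) (x : L) : L := if a then 0 else - E true x.
have lS a : linear (S a) by case: a => c x y; rewrite /S; fn_ring.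
rewrite (@act_series_intertwine _ _ _ _ sum_qr _ (fun a y => F a y + S a y)) //; last first.
  by case=> -[[q p] r]; rewrite /sum_qr; op_norm; rewrite /S; fn_ring.
rewrite /shuffle_side; apply: eq_bigr => i _.
rewrite /= step123 (@act_deg_add_single _ F S false) //.
by case=> -[] y; rewrite /S; fn_ring.
Qed.

(* The last edge, on (q + r, p + r): the second component is constant and the first one moves
   by commuting operators, up to a multiple of the second. *)
Let opR (a : bool) (x : L * L) : L * L :=
  if a then (F true (x.1 - x.2), 0) else (E true x.1, 0).

Let opR_linear a : linear (opR a).
Proof.
by case: a => c [p r] [p' r']; rewrite /opR /= ?(pairD, pairN, pairZ) /=;
  congr (_, _); fn_ring.
Qed.

Let act_deg_opR n x : act_deg Phi opR n x =
  if n is m.+1 then (- correction m x.2, 0) else x.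
Proof.
case: n => [|n]; first by rewrite /act_deg big_words0 grouplike_nil // scale1r.
pose inj (y : L) : L * L := (y, 0).
have linj : linear inj by move=> c y z; rewrite /inj ?(pairD, pairN, pairZ) scaler0 addr0.
pose B (a : bool) := if a then F true else E true.
have lB a : linear (B a) by case: a; [exact: lF | exact: lE].
have injB a y : inj (B a y) = opR a (inj y) by case: a; rewrite /inj /opR /= ?subr0.
(* Phi acts as 1 on (x.1, 0) since E_1 and F_1 commute. On (0, x.2) only the words that end
   with e_1 contribute. *)
have -> : x = inj x.1 + (0, x.2) by case: x => a b; rewrite /inj pairD addr0 add0r.
rewrite (linD (linear_act_deg Phi n.+1 opR_linear)) -(@act_deg_intertwine _ _ _ _ inj B) //.
have inj0 : inj 0 = 0 by [].
have -> : act_deg Phi B n.+1 x.1 = 0.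
  by rewrite (@act_deg_comm _ (E true) (F true)) // => y; rewrite EF.
rewrite inj0 add0r /act_deg big_words_rcons /= big1 ?add0r => [|w _]; last first.
  rewrite foldr_rcons [opR false _](_ : _ = 0) ?(lin0 (linear_foldr w opR_linear)) ?scaler0 //.
  by rewrite /opR /= (lin0 (lE true)).
rewrite -[RHS]/(inj (- correction n x.2)) linN // lin_sum // -sumrN; apply: eq_bigr => w _.
have -> : foldr opR (0, x.2) (rcons w true) = inj (foldr B (- F true x.2) w).
  rewrite foldr_rcons (foldr_intertwine injB); congr foldr.
  by rewrite /opR /inj /= sub0r (linN (lF true)).
by rewrite (linN (linear_foldr w lB)) (linN linj) scalerN (linZ linj).
Qed.

Let act_series_opR2 n x : (act_series Phi opR x n).2 = (x n).2.
Proof.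
rewrite /act_series; have l2 : linear (fun y : L * L => y.2) by move=> c [p r] [p' r'].
rewrite (lin_sum l2) big_ord_recl /= act_deg_opR subn0 big1 ?addr0 // => i _.
by rewrite act_deg_opR.
Qed.

Let act_series_opR1 n x : (act_series Phi opR x n).1 =
  (x n).1 - \sum_(i < n) correction i (x (n - i.+1)%N).2.
Proof.
rewrite /act_series; have l1 : linear (fun y : L * L => y.1) by move=> c [p r] [p' r'].
rewrite (lin_sum l1) big_ord_recl /= act_deg_opR subn0 -sumrN; congr (_ + _).
by apply: eq_bigr => i _; rewrite act_deg_opR.
Qed.

(** The two sides of the pentagon have equal sums q + r and p + r. On the side of two edges both
    are the harmonic coproduct, because q = p there. *)
Theorem shuffle_harmonic n :
  shuffle_side n = harmonic_side n + \sum_(i < n) correction i (harmonic_side (n - i.+1)%N).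
Proof.
have lth : linear (fun x => (sum_qr x, sum_pr x)).
  by move=> c x y; rewrite sum_qr_linear sum_pr_linear pairZ pairD.
pose x2 := act_series Phi ops1_23_4 (act_series Phi ops123 (const_seq w0)).
have e m : act_series Phi opR (fun i => (sum_qr (x2 i), sum_pr (x2 i))) m =
    (harmonic_side m, harmonic_side m).
  have <- : (sum_qr (act_series Phi ops12_34 (act_series Phi ops12_3_4 (const_seq w0)) m),
          sum_pr (act_series Phi ops12_34 (act_series Phi ops12_3_4 (const_seq w0)) m)) =
      (harmonic_side m, harmonic_side m).
    rewrite (@eq_act_series _ _ _ ops12_34 ops12_34 _ (const_seq w0)) //.
    rewrite step12_34 /harmonic_side /sum_qr /sum_pr.
    by case: (act_deg _ _ _ _).
  rewrite -pentagon_act_series -/x2.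
  rewrite (@act_series_intertwine _ _ _ _ (fun x => (sum_qr x, sum_pr x)) _ opR) //.
  by case=> -[[q p] r]; rewrite /sum_qr /sum_pr /opR; op_norm; congr (_, _); fn_ring.
have e2 m : sum_pr (x2 m) = harmonic_side m by have := congr1 snd (e m); rewrite act_series_opR2.
have := congr1 fst (e n); rewrite act_series_opR1 /= {1}/x2 step1_23_4 => <-.
by under eq_bigr => i _ do rewrite e2; rewrite addrNK.
Qed.

End Pentagon.
End MainIdentity.

(** * Formal power series in one variable *)

Definition fps (R : Type) := nat -> R.

Section FormalSeries.
Variable R : comNzRingType.
Implicit Types f g h : fps R.

Lemma fpsP f g : (forall n, f n = g n) -> f = g.
Proof. by move=> fg; apply: funext. Qed.

HB.instance Definition _ := gen_eqMixin (fps R).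
HB.instance Definition _ := gen_choiceMixin (fps R).

Let addf f g : fps R := fun n => f n + g n.
Let oppf f : fps R := fun n => - f n.
Let zerof : fps R := fun=> 0.
Let mulf f g : fps R := fun n => \sum_(i < n.+1) f i * g (n - i)%N.
Let onef : fps R := fun n => (n == 0%N)%:R.

Let addfA : associative addf. Proof. by move=> f g h; apply: fpsP => n; exact: addrA. Qed.
Let addfC : commutative addf. Proof. by move=> f g; apply: fpsP => n; exact: addrC. Qed.
Let add0f : left_id zerof addf. Proof. by move=> f; apply: fpsP => n; exact: add0r. Qed.
Let addNf : left_inverse zerof oppf addf.
Proof. by move=> f; apply: fpsP => n; exact: addNr. Qed.

HB.instance Definition _ := GRing.isZmodule.Build (fps R) addfA addfC add0f addNf.

Let mulfA : associative mulf.
Proof.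
move=> f g h; apply: fpsP => n; rewrite /mulf.
under [RHS]eq_bigr => l _ do rewrite mulr_suml.
transitivity (\sum_(l < n.+1) \sum_(i < l.+1) f i * g (l - i)%N * h (n - (i + (l - i)))%N).
  rewrite (sum_triangle n (fun i j => f i * g j * h (n - (i + j))%N)).
  apply: eq_bigr => i _; rewrite mulr_sumr; apply: eq_bigr => j _.
  by rewrite mulrA subnDA.
by apply: eq_bigr => l _; apply: eq_bigr => i _; rewrite subnKC // -ltnS.
Qed.

Let mulfC : commutative mulf.
Proof.
move=> f g; apply: fpsP => n; rewrite /mulf (reindex_inj rev_ord_inj) /=.
by apply: eq_bigr => i _; rewrite subSS subKn 1?mulrC // -ltnS.
Qed.

Let mul1f : left_id onef mulf.
Proof.
move=> f; apply: fpsP => n; rewrite /mulf big_ord_recl subn0 mul1r big1 ?addr0 // => i _.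
by rewrite mul0r.
Qed.

Let mulfDl : left_distributive mulf addf.
Proof.
move=> f g h; apply: fpsP => n; rewrite /mulf /addf -big_split.
by apply: eq_bigr => i _; rewrite mulrDl.
Qed.

Let onef_neq0 : onef != 0.
Proof. by apply/eqP => /(congr1 (fun f => f 0%N)) /eqP; rewrite oner_eq0. Qed.

HB.instance Definition _ := GRing.Zmodule_isComNzRing.Build (fps R)
  mulfA mulfC mul1f mulfDl onef_neq0.

Let scalef c f : fps R := fun n => c * f n.
Let scalefA c d f : scalef c (scalef d f) = scalef (c * d) f.
Proof. by apply: fpsP => n; exact: mulrA. Qed.
Let scale1f : left_id 1 scalef. Proof. by move=> f; apply: fpsP => n; exact: mul1r. Qed.
Let scalefDr : right_distributive scalef +%R.
Proof. by move=> c f g; apply: fpsP => n; exact: mulrDr. Qed.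
Let scalefDl f : {morph scalef^~ f : c d / c + d}.
Proof. by move=> c d; apply: fpsP => n; exact: mulrDl. Qed.

HB.instance Definition _ :=
  GRing.Zmodule_isLmodule.Build R (fps R) scalefA scale1f scalefDr scalefDl.

Let scalefAl (c : R) f g : c *: (f * g) = (c *: f) * g.
Proof.
apply: fpsP => n; rewrite -[LHS]/(c * \sum_(i < n.+1) f i * g (n - i)%N) mulr_sumr.
by apply: eq_bigr => i _; exact: mulrA.
Qed.

HB.instance Definition _ := GRing.Lmodule_isLalgebra.Build R (fps R) scalefAl.

Let scalefAr (c : R) f g : c *: (f * g) = f * (c *: g).
Proof. by rewrite mulrC scalefAl mulrC. Qed.

HB.instance Definition _ := GRing.Lalgebra_isAlgebra.Build R (fps R) scalefAr.

Lemma fpsZ c f n : (c *: f) n = c * f n. Proof. by []. Qed.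
Lemma fpsD f g n : (f + g) n = f n + g n. Proof. by []. Qed.
Lemma fpsN f n : (- f) n = - f n. Proof. by []. Qed.
Lemma fps0 n : (0 : fps R) n = 0. Proof. by []. Qed.
Lemma fps1 n : (1 : fps R) n = (n == 0%N)%:R. Proof. by []. Qed.
Lemma fpsM f g n : (f * g) n = \sum_(i < n.+1) f i * g (n - i)%N. Proof. by []. Qed.
Lemma fps_sum I (r : seq I) (P : pred I) (F : I -> fps R) n :
  (\sum_(i <- r | P i) F i) n = \sum_(i <- r | P i) F i n.
Proof. by elim/big_rec2: _ => // i y1 y2 _ <-. Qed.
Lemma fpsMn f m n : (f *+ m) n = f n *+ m.
Proof. by elim: m => // m IH; rewrite !mulrS fpsD IH. Qed.

Definition fpsX : fps R := fun n => (n == 1%N)%:R.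
Lemma fpsXM f n : (fpsX * f) n = if n is m.+1 then f m else 0.
Proof.
rewrite fpsM; case: n => [|n]; first by rewrite big_ord1 mul0r.
rewrite big_ord_recl mul0r add0r big_ord_recl /= mul1r subSS subn0.
by rewrite big1 ?addr0 // => i _; rewrite mul0r.
Qed.

Definition fps_deriv f : fps R := fun n => f n.+1 *+ n.+1.

Lemma fps_derivD f g : fps_deriv (f + g) = fps_deriv f + fps_deriv g.
Proof. by apply: fpsP => n; rewrite fpsD /fps_deriv fpsD mulrnDl. Qed.

Lemma fps_derivZ c f : fps_deriv (c *: f) = c *: fps_deriv f.
Proof. by apply: fpsP => n; rewrite fpsZ /fps_deriv fpsZ mulrnAr. Qed.

Lemma fps_derivN f : fps_deriv (- f) = - fps_deriv f.
Proof. by apply: fpsP => n; rewrite fpsN /fps_deriv fpsN mulNrn. Qed.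

Lemma fps_deriv0 : fps_deriv 0 = 0.
Proof. by apply: fpsP => n; rewrite /fps_deriv fps0 mul0rn. Qed.

Lemma fps_deriv_sum I (r : seq I) (P : pred I) (F : I -> fps R) :
  fps_deriv (\sum_(i <- r | P i) F i) = \sum_(i <- r | P i) fps_deriv (F i).
Proof.
elim: r => [|i r IH]; rewrite ?big_nil ?fps_deriv0 // !big_cons.
by case: (P i); rewrite // fps_derivD IH.
Qed.

(** The factor n + 1 is distributed over the pair of exponents with that sum. *)
Lemma fps_derivM f g : fps_deriv (f * g) = fps_deriv f * g + f * fps_deriv g.
Proof.
apply: fpsP => n; rewrite fpsD /fps_deriv !fpsM -sumrMnl.
transitivity (\sum_(i < n.+2) (f i *+ i * g (n.+1 - i)%N + f i * (g (n.+1 - i)%N *+ (n.+1 - i)))).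
  apply: eq_bigr => i _; rewrite mulrnAl mulrnAr -mulrnDr subnKC //.
  by rewrite -ltnS.
rewrite big_split; congr (_ + _).
  by rewrite [LHS]big_ord_recl /= mulr0n mul0r add0r; apply: eq_bigr => i _; rewrite subSS.
rewrite [LHS]big_ord_recr /= subnn mulr0n mulr0 addr0; apply: eq_bigr => i _.
by rewrite subSn // -ltnS.
Qed.

Lemma fps_deriv1 : fps_deriv 1 = 0.
Proof. by apply: fpsP => n; rewrite /fps_deriv fps1 mul0rn. Qed.

Lemma fps_derivX : fps_deriv fpsX = 1.
Proof. by apply: fpsP => -[|n]; rewrite /fps_deriv /fpsX fps1 //= mul0rn. Qed.

Lemma fps_derivXn f n : fps_deriv (f ^+ n.+1) = (f ^+ n * fps_deriv f) *+ n.+1.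
Proof.
elim: n => [|n IH]; first by rewrite expr1 expr0 mul1r mulr1n.
rewrite exprS fps_derivM IH [RHS]mulrS; congr (_ + _); first exact: mulrC.
by rewrite mulrnAr mulrA -exprS.
Qed.

End FormalSeries.

(** * The correction series is a cocycle *)

Lemma sum_words_false (V : nmodType) n (f : word -> V) :
  (forall w, true \in w -> f w = 0) -> \sum_(w <- words n) f w = f (nseq n false).
Proof.
elim: n f => [|n IH] f f0; first by rewrite big_words0.
rewrite big_wordsS [X in _ + X]big1 ?addr0 => [|w _]; last by rewrite f0 ?inE.
by rewrite IH // => w tw; rewrite f0 // inE tw orbT.
Qed.

Section DualOperators.
Variable k : comNzRingType.

(** Functions on bool * T stand for pairs of functions on T. *)
Definition pairfn T (p r : fn k T) : fn k (bool * T) := fun t => if t.1 then r t.2 else p t.2.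
Definition component T (b : bool) (f : fn k (bool * T)) : fn k T := fun t => f (b, t).
Definition shift (f : fn k nat) : fn k nat := fun n => if n is m.+1 then f m else 0.
Definition fn1 : fn k nat := fun n => (n == 0%N)%:R.

Lemma pairfn_linear T (V : lmodType k) (f g : V -> fn k T) :
  linear f -> linear g -> linear (fun x => pairfn (f x) (g x)).
Proof. by move=> lf lg c x y; apply: fnP => -[[] t] /=; rewrite /pairfn /= ?lf ?lg. Qed.

Lemma component_linear T b : linear (@component T b). Proof. by []. Qed.

Lemma shift_linear : linear shift.
Proof. by move=> c f g; apply: fnP => -[|n] //=; rewrite fnD fnZ /= mulr0 addr0. Qed.

Lemma lin_comp (V V' V'' : lmodType k) (f : V' -> V'') (g : V -> V') :
  linear f -> linear g -> linear (fun x => f (g x)).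
Proof. by move=> lf lg c x y; rewrite lg lf. Qed.

Lemma lin_id (V : lmodType k) : linear (fun x : V => x). Proof. by []. Qed.

Lemma lin_zero (V V' : lmodType k) : linear (fun _ : V => 0 : V').
Proof. by move=> c x y; rewrite scaler0 addr0. Qed.

End DualOperators.

Section Scalars.
Variables (k : comNzRingType) (Phi : Vhat k).
Hypothesis gPhi : grouplikeV Phi.
Hypothesis Phi_pow : forall b n, Phi (nseq n.+1 b) = 0.
Hypothesis pentPhi : pentagon Phi.
Local Notation X := (fpsX k).
Local Notation S := (fps k).

(** zeta n is zeta_(n+1) = (Phi|e_0^n e_1), which plays the role of the zeta value at n + 1. *)
Definition zeta n : k := Phi (rcons (nseq n false) true).
(** The component of degree i + 1 of C(x, y), at x = 1 and y = Y; it is homogeneous, so this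
    specialization loses nothing. *)
Definition corr_coef i : S := \sum_(w <- words i) Phi (rcons w true) *: X ^+ (count id w).+1.
(** C(T, TY), as a power series in T with coefficients in k[[Y]]. *)
Definition corr_series : fps S := fun n => if n is i.+1 then corr_coef i else 1.

Lemma corr_series_mul (G : fps S) n :
  (corr_series * G) n = G n + \sum_(i < n) corr_coef i * G (n - i.+1)%N.
Proof. by rewrite fpsM big_ord_recl mul1r subn0. Qed.

Lemma shuffle_side_left (T : Type) (E F : bool -> fn k T -> fn k T) o n :
  (forall a, linear (E a)) -> (forall a, linear (F a)) ->
  (forall y, F false y = 0) -> shuffle_side Phi E F o n = act_deg Phi E n o.
Proof.
move=> lE lF F0; rewrite /shuffle_side big_ord_recl subn0.
rewrite (@act_deg_single_gt0 _ _ gPhi Phi_pow _ F true) //.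
rewrite big1 ?addr0 // => i _; exact: (@act_deg_single_gt0 _ _ gPhi Phi_pow _ F true).
Qed.

Lemma shuffle_side_right (T : Type) (E F : bool -> fn k T -> fn k T) o n :
  (forall a, linear (E a)) -> (forall a, linear (F a)) ->
  (forall y, E false y = 0) -> shuffle_side Phi E F o n = act_deg Phi F n o.
Proof.
move=> lE lF E0; rewrite /shuffle_side big_ord_recr /= subnn.
rewrite (@act_deg_single_gt0 _ _ gPhi Phi_pow _ E true) //.
rewrite big1 ?add0r // => i _; rewrite (@act_deg_single_gt0 _ _ gPhi Phi_pow _ E true) //.
by rewrite (act_deg_const0 Phi) // subn_eq0 leqNgt ltn_ord.
Qed.

Section Corr.
Variables (T : Type) (E F : bool -> fn k T -> fn k T).
Hypotheses (lE : forall a, linear (E a)) (lF : forall a, linear (F a)).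
Variables (c0 c1 : fn k T -> S).
Hypotheses (lc0 : linear c0) (lc1 : linear c1).

(** The case F_1 = z with z^2 = 0, c0 + c1 z being the value: only the words without e_1, to
    which one factor F_1 is added, survive. *)
Lemma correction_infinitesimal (u : S) i x :
  (forall f, c0 (E true f) = u * c0 f) -> (forall f, c1 (E true f) = u * c1 f) ->
  (forall f, c0 (F true f) = 0) -> (forall f, c1 (F true f) = c0 f) ->
  c0 (correction Phi E F i x) = 0 /\ c1 (correction Phi E F i x) = zeta i *: (u ^+ i * c0 x).
Proof.
move=> c0E c1E c0F c1F.
set B := fun a : bool => if a then F true else E true.
have h0 w : c0 (foldr B (F true x) w) = 0.
  by elim: w => [|[] w IH] /=; rewrite ?c0F ?c0E ?IH ?mulr0.
split; rewrite /correction lin_sum //.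
  by apply: big1 => w _; rewrite linZ // h0 scaler0.
rewrite (@sum_words_false _ _ (fun w => c1 (Phi (rcons w true) *: foldr B (F true x) w))).
  rewrite linZ //; congr (_ *: _); elim: i => [|i IH] /=; first by rewrite c1F mul1r.
  by rewrite c1E IH exprS mulrA.
move=> w tw; rewrite linZ //; suff -> : c1 (foldr B (F true x) w) = 0 by rewrite scaler0.
elim: w tw => //= -[] w IH; rewrite inE /= ?c1F ?h0 // => tw.
by rewrite c1E IH ?mulr0.
Qed.

(** The case E_1 = 1, F_1 = Y. *)
Lemma correction_finite i x :
  (forall f, c0 (E true f) = c0 f) -> (forall f, c0 (F true f) = X * c0 f) ->
  c0 (correction Phi E F i x) = corr_coef i * c0 x.
Proof.
move=> c0E c0F; rewrite /correction lin_sum // /corr_coef mulr_suml; apply: eq_bigr => w _.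
rewrite linZ // -scalerAl; congr (_ *: _).
elim: w => [|[] w IH] /=; first by rewrite c0F expr1.
  by rewrite c0F IH add1n [in RHS]exprS mulrA.
by rewrite c0E IH add0n.
Qed.

(** The case E_1 = 1, F_1 = Y + z with z^2 = 0: the coefficient of z is a derivative. *)
Lemma correction_deriv i x :
  (forall f, c0 (E true f) = c0 f) -> (forall f, c0 (F true f) = X * c0 f) ->
  (forall f, c1 (E true f) = c1 f) -> (forall f, c1 (F true f) = X * c1 f + c0 f) ->
  c1 (correction Phi E F i x) = corr_coef i * c1 x + fps_deriv (corr_coef i) * c0 x.
Proof.
move=> c0E c0F c1E c1F; rewrite /correction lin_sum //.
rewrite /corr_coef fps_deriv_sum !mulr_suml -big_split.
apply: eq_bigr => w _; rewrite linZ // fps_derivZ -!scalerAl /= -scalerDr; congr (_ *: _).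
set B := fun a : bool => if a then F true else E true.
have h0 v : c0 (foldr B (F true x) v) = X ^+ (count id v).+1 * c0 x.
  elim: v => [|[] v IH] /=; first by rewrite c0F expr1.
    by rewrite c0F IH add1n [in RHS]exprS mulrA.
  by rewrite c0E IH add0n.
elim: w => [|[] w IH] /=.
- by rewrite c1F expr1 fps_derivX mul1r.
- by rewrite c1F IH h0 add1n [in RHS]exprS fps_derivM fps_derivX; ring.
- by rewrite c1E IH add0n.
Qed.

End Corr.

Local Notation D := (fn k (bool * nat)).
Local Notation D2 := (fn k (bool * (bool * nat))).
(* D is k[[Y]] + k[[Y]] z with z^2 = 0, the first component of a pair being the constant term
   in z, and D2 consists of pairs (p, r) of elements of D, with rho = p + r. *)
Let mulY (f : D) : D := pairfn (shift (component false f)) (shift (component true f)).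
Let mulz (f : D) : D := pairfn 0 (component false f).
Let d1 : D := pairfn (fn1 k) 0.
Let rho (f : D2) : D := component false f + component true f.
Let o2 : D2 := pairfn d1 0.

Ltac lin_tac := do ?[exact: lin_id | exact: lin_zero | exact: component_linear |
  exact: shift_linear | apply: pairfn_linear | apply: lin_add | apply: lin_opp
  | apply: (lin_comp (@component_linear _ _ _)) | apply: (lin_comp (@shift_linear _)) ].

Let mulY_linear : linear mulY. Proof. by rewrite /mulY; lin_tac. Qed.
Let mulz_linear : linear mulz. Proof. by rewrite /mulz; lin_tac. Qed.
Let rho_linear : linear rho. Proof. by rewrite /rho; lin_tac. Qed.

(* The identity [shuffle_harmonic] is applied to four pairs (E, F). With E_0 = F_0 = 0 and
   scalars (E_1, F_1): (1, Y) and (Y, z). With one of the pairs given by the matrices opM for two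
   scalars: E = (0, 1) and F = M(Y, z); E = M(1, Y) and F = (0, z). *)
Let E1Y (a : bool) (f : fn k nat) : fn k nat := if a then f else 0.
Let F1Y (a : bool) (f : fn k nat) : fn k nat := if a then shift f else 0.
Let EYz (a : bool) (f : D) : D := if a then mulY f else 0.
Let FYz (a : bool) (f : D) : D := if a then mulz f else 0.
Let E1_Yz (a : bool) (f : D2) : D2 := if a then f else 0.
Let F1_Yz (a : bool) (f : D2) : D2 :=
  if a then pairfn (mulY (rho f)) (mulz (rho f)) else pairfn (- mulY (component true f)) 0.
Let E1Y_z (a : bool) (f : D2) : D2 :=
  if a then pairfn (rho f) (mulY (rho f)) else pairfn (- component true f) 0.
Let F1Y_z (a : bool) (f : D2) : D2 :=
  if a then pairfn (mulz (component false f)) (mulz (component true f)) else 0.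

Ltac lin_tac_rho := do ?[exact: lin_id | exact: lin_zero | exact: component_linear |
  exact: rho_linear | exact: shift_linear | exact: mulY_linear | exact: mulz_linear
  | apply: (lin_comp mulY_linear) | apply: (lin_comp mulz_linear)
  | apply: pairfn_linear | apply: lin_add | apply: lin_opp ].
Let E1Y_linear a : linear (E1Y a). Proof. by case: a; lin_tac_rho. Qed.
Let F1Y_linear a : linear (F1Y a). Proof. by case: a; lin_tac_rho. Qed.
Let EYz_linear a : linear (EYz a). Proof. by case: a; lin_tac_rho. Qed.
Let FYz_linear a : linear (FYz a). Proof. by case: a; lin_tac_rho. Qed.
Let E1_Yz_linear a : linear (E1_Yz a). Proof. by case: a; lin_tac_rho. Qed.
Let F1_Yz_linear a : linear (F1_Yz a). Proof. by case: a; lin_tac_rho. Qed.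
Let E1Y_z_linear a : linear (E1Y_z a). Proof. by case: a; lin_tac_rho. Qed.
Let F1Y_z_linear a : linear (F1Y_z a). Proof. by case: a; lin_tac_rho. Qed.

Ltac pt := rewrite /E1Y /F1Y /EYz /FYz /E1_Yz /F1_Yz /E1Y_z /F1Y_z /rho /mulY /mulz /o2
  /d1 /component /pairfn /shift /fn1 /= ?(fnD, fnN, fn0) /= ?(fnD, fnN, fn0) /= ?(fnD, fnN, fn0) /=;
  first [by ring | exact: (esym (@oppr0 k))].
Let EF1Y a b x : E1Y a (F1Y b x) = F1Y b (E1Y a x).
Proof. by apply: fnP => -[|n]; case: a; case: b; pt. Qed.
Let EFYz a b x : EYz a (FYz b x) = FYz b (EYz a x).
Proof. by apply: fnP => -[[] [|n]]; case: a; case: b; pt. Qed.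
Let EF1_Yz a b x : E1_Yz a (F1_Yz b x) = F1_Yz b (E1_Yz a x).
Proof. by apply: fnP => -[[] [[] [|n]]]; case: a; case: b; pt. Qed.
Let EF1Y_z a b x : E1Y_z a (F1Y_z b x) = F1Y_z b (E1Y_z a x).
Proof. by apply: fnP => -[[] [[] [|n]]]; case: a; case: b; pt. Qed.

Let o1 : fn k nat := fn1 k.

Let as_fps (f : fn k nat) : S := f.
Let as_fps_linear : linear as_fps. Proof. by []. Qed.
Let as_fps_shift f : as_fps (shift f) = X * as_fps f.
Proof. by apply: fpsP => n; rewrite fpsXM; case: n. Qed.

Let coefz b (f : D) : S := as_fps (component b f).
Let coefz_linear b : linear (coefz b). Proof. by []. Qed.

(* The inverse K of C, at (x, y) = (1, Y). *)
Let kernel : fps S := fun n => as_fps (harmonic_side Phi E1Y F1Y o1 n).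

(* The analogue of opM for the three scalars 1, Y, z: both bracketings have it as a quotient,
   and this is how coassociativity of the harmonic coproduct enters. *)
Let opN (a : bool) (x : D * D * D) : D * D * D := let: (s, t, u) := x in
  if a then (s + mulY s + mulz s, mulY s + mulz s, mulz s) else (- t - mulY u, - mulY u, 0).
Let kernel3 n : D := (act_deg Phi opN n (d1, 0, 0)).1.1.
(* K(Y, z) *)
Let kernelYz n : D := harmonic_side Phi EYz FYz d1 n.

(** For scalars E_1 = 1, F_1 = Y the left side of [shuffle_harmonic] is 1. *)
Lemma corr_series_kernel : corr_series * kernel = 1.
Proof.
apply: fpsP => n; rewrite corr_series_mul.
have shE : shuffle_side Phi E1Y F1Y o1 n = const_seq o1 n.
  by rewrite shuffle_side_left // (@act_deg_single_gt0 _ _ gPhi Phi_pow _ E1Y true).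
have := shuffle_harmonic gPhi Phi_pow E1Y_linear F1Y_linear EF1Y pentPhi (o := o1) erefl erefl n.
rewrite shE => /(congr1 as_fps) e; transitivity (as_fps (const_seq o1 n)).
  rewrite e (linD as_fps_linear) (lin_sum as_fps_linear); congr (_ + _); apply: eq_bigr => i _.
  by rewrite (correction_finite as_fps_linear) // => f; rewrite /F1Y as_fps_shift.
by case: n {shE e}.
Qed.

Let harmonic_intertwine (T : Type) (E F : bool -> fn k T -> fn k T) o n
    (tau : fn k T * fn k T -> D * D * D) (sigma : fn k T -> D) :
  linear tau -> linear sigma ->
  (forall a x, tau (opM E F a x) = opN a (tau x)) ->
  (forall x, (tau x).1.1 = sigma (x.1 + x.2)) -> tau (o, 0) = (d1, 0, 0) ->
  sigma (harmonic_side Phi E F o n) = kernel3 n.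
Proof.
move=> lt ls opt st t0; rewrite /kernel3 -t0 -(act_deg_intertwine Phi lt opt) st /harmonic_side.
by case: (act_deg _ _ _ _).
Qed.

Let triple_linear (V V1 V2 V3 : lmodType k) (f : V -> V1) (g : V -> V2) (h : V -> V3) :
  linear f -> linear g -> linear h -> linear (fun x => (f x, g x, h x)).
Proof. by move=> lf lg lh c x y; rewrite lf lg lh. Qed.

Let lin1 (V V' : lmodType k) : linear (fun x : V * V' => x.1). Proof. by []. Qed.
Let lin2 (V V' : lmodType k) : linear (fun x : V * V' => x.2). Proof. by []. Qed.

Let pairPD (p q : D * D * D) : p.1.1 = q.1.1 -> p.1.2 = q.1.2 -> p.2 = q.2 -> p = q.
Proof. by case: p q => [[a b] c] [[a' b'] c'] /= -> -> ->. Qed.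

Let harmonic_left n : rho (harmonic_side Phi E1Y_z F1Y_z o2 n) = kernel3 n.
Proof.
apply: (@harmonic_intertwine _ _ _ _ _ (fun x =>
  (rho x.1 + rho x.2, component true x.1 + rho x.2, rho x.2)) rho).
- by apply: triple_linear; do ?apply: lin_add; do ?[apply: (lin_comp rho_linear);
    [exact: lin1 || exact: lin2] | apply: (lin_comp (@component_linear _ _ _)); exact: lin1].
- exact: rho_linear.
- by case=> -[p r]; rewrite /opM /opN /=; apply: pairPD; apply: fnP => -[[] [|t]]; pt.
- by case=> p r; rewrite /= (linD rho_linear).
- by apply: pairPD; apply: fnP => -[[] [|t]]; pt.
Qed.

Let harmonic_right n : rho (harmonic_side Phi E1_Yz F1_Yz o2 n) = kernel3 n.
Proof.
apply: (@harmonic_intertwine _ _ _ _ _ (fun x =>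
  (rho x.1 + rho x.2, rho x.2, component true x.2)) rho).
- by apply: triple_linear; do ?apply: lin_add; do ?[apply: (lin_comp rho_linear);
    [exact: lin1 || exact: lin2] | apply: (lin_comp (@component_linear _ _ _)); exact: lin2].
- exact: rho_linear.
- by case=> -[p r]; rewrite /opM /opN /=; apply: pairPD; apply: fnP => -[[] [|t]]; pt.
- by case=> p r; rewrite /= (linD rho_linear).
- by apply: pairPD; apply: fnP => -[[] [|t]]; pt.
Qed.

Let shuffle_left n : rho (shuffle_side Phi E1Y_z F1Y_z o2 n) =
  pairfn (harmonic_side Phi E1Y F1Y o1 n) 0.
Proof.
rewrite shuffle_side_left //.
pose tau (x : fn k nat * fn k nat) : D2 := pairfn (pairfn x.1 0) (pairfn x.2 0).
have lt : linear tau.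
  by do ?apply: pairfn_linear; [exact: lin1 | exact: lin_zero | exact: lin2 | exact: lin_zero].
have opt a x : tau (opM E1Y F1Y a x) = E1Y_z a (tau x).
  by case: a x => -[p r]; apply: fnP => -[[] [[] [|t]]]; rewrite /tau /opM /=; pt.
have -> : o2 = tau (o1, 0) by apply: fnP => -[[] [[] [|t]]].
rewrite -(act_deg_intertwine Phi lt opt) /harmonic_side; case: (act_deg _ _ _ _) => p r.
by apply: fnP => -[[] t]; rewrite /tau /=; pt.
Qed.

Let shuffle_right n : rho (shuffle_side Phi E1_Yz F1_Yz o2 n) = kernelYz n.
Proof.
rewrite shuffle_side_right //.
pose tau (x : D * D) : D2 := pairfn x.1 x.2.
have lt : linear tau by apply: pairfn_linear; [exact: lin1 | exact: lin2].
have opt a x : tau (opM EYz FYz a x) = F1_Yz a (tau x).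
  by case: a x => -[p r]; apply: fnP => -[[] [[] [|t]]]; rewrite /tau /opM /=; pt.
have -> : o2 = tau (d1, 0) by apply: fnP => -[[] [[] [|t]]].
by rewrite -(act_deg_intertwine Phi lt opt) /kernelYz /harmonic_side; case: (act_deg _ _ _ _).
Qed.

(** sum_n zeta_(n+1) (T u)^n *)
Definition zeta_series (u : S) : fps S := fun n => zeta n *: u ^+ n.
Definition derivY (f : fps S) : fps S := fun n => fps_deriv (f n).

Lemma fpsXM_sum (Z G : fps S) n :
  (fpsX S * (Z * G)) n = \sum_(i < n) Z i * G (n - i.+1)%N.
Proof.
rewrite fpsXM; case: n => [|n]; first by rewrite big_ord0.
by rewrite fpsM; apply: eq_bigr => i _; rewrite subSS.
Qed.

Let coefz_rho b f : S := coefz b (rho f).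
Let coefz_rho_linear b : linear (coefz_rho b).
Proof. by move=> c f g; rewrite /coefz_rho rho_linear coefz_linear. Qed.

Let coefz_mulY b f : coefz b (mulY f) = X * coefz b f.
Proof. by case: b; rewrite -as_fps_shift. Qed.

(* K(1, Y) = C(1 + Y, z) K(1, Y, z), with C(x, z) = 1 + sum_n zeta_(n+1) x^n z modulo z^2 *)
Let left_bracketing n : coefz false (kernel3 n) = kernel n /\
  coefz true (kernel3 n) = - (fpsX S * (zeta_series (1 + X) * kernel)) n.
Proof.
have ci i x := @correction_infinitesimal _ E1Y_z F1Y_z (coefz_rho false) (coefz_rho true)
  (coefz_rho_linear false) (coefz_rho_linear true) (1 + X) i x.
have cE b f : coefz_rho b (E1Y_z true f) = (1 + X) * coefz_rho b f.
  rewrite /coefz_rho [rho (E1Y_z true f)](_ : _ = rho f + mulY (rho f)) //.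
  by rewrite (linD (coefz_linear b)) coefz_mulY mulrDl mul1r.
have cF0 f : coefz_rho false (F1Y_z true f) = 0.
  by apply: fpsP => t; rewrite /coefz_rho /coefz /as_fps /=; pt.
have cF1 f : coefz_rho true (F1Y_z true f) = coefz_rho false f.
  by apply: fpsP => t; rewrite /coefz_rho /coefz /as_fps /=; pt.
have Eo : E1Y_z false o2 = 0 by apply: fnP => -[[] [[] [|t]]]; pt.
pose H := harmonic_side Phi E1Y_z F1Y_z o2.
have eq b m : coefz_rho b (shuffle_side Phi E1Y_z F1Y_z o2 m) = coefz_rho b (H m) +
    \sum_(i < m) coefz_rho b (correction Phi E1Y_z F1Y_z i (H (m - i.+1)%N)).
  rewrite (shuffle_harmonic gPhi Phi_pow E1Y_z_linear F1Y_z_linear EF1Y_z pentPhi Eo erefl m).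
  by rewrite (linD (coefz_rho_linear b)) (lin_sum (coefz_rho_linear b)).
have e0 m : coefz false (kernel3 m) = kernel m.
  have := eq false m; rewrite {1 2}/coefz_rho /H shuffle_left harmonic_left big1 ?addr0 // => i _.
  by case: (ci i (H (m - i.+1)%N) (cE false) (cE true) cF0 cF1).
split=> //; have := eq true n; rewrite {1 2}/coefz_rho /H shuffle_left harmonic_left => /esym/eqP.
rewrite [X in _ == X](_ : _ = 0) // addr_eq0 => /eqP ->; congr (- _).
rewrite fpsXM_sum; apply: eq_bigr => i _.
case: (ci i (H (n - i.+1)%N) (cE false) (cE true) cF0 cF1) => _ ->.
by rewrite /coefz_rho /H harmonic_left e0 /zeta_series -scalerAl.
Qed.

(* K(Y, z) = 1 - sum_n zeta_(n+1) Y^n z modulo z^2 *)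
Let kernelYz_components n : coefz false (kernelYz n) = (n == 0%N)%:R /\
  coefz true (kernelYz n) = - (fpsX S * zeta_series X) n.
Proof.
have ci i x := @correction_infinitesimal _ EYz FYz (coefz false) (coefz true)
  (coefz_linear false) (coefz_linear true) X i x.
have cE b f : coefz b (EYz true f) = X * coefz b f by rewrite -coefz_mulY.
have cF0 f : coefz false (FYz true f) = 0 by apply: fpsP => t.
have cF1 f : coefz true (FYz true f) = coefz false f by apply: fpsP => t.
have eq b m : coefz b (const_seq d1 m) = coefz b (kernelYz m) +
    \sum_(i < m) coefz b (correction Phi EYz FYz i (kernelYz (m - i.+1))).
  rewrite -(lin_sum (coefz_linear b)) -(linD (coefz_linear b)); congr (coefz b _).
  rewrite /kernelYz -(shuffle_harmonic gPhi Phi_pow EYz_linear FYz_linear EFYz pentPhi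
    erefl erefl m).
  by rewrite shuffle_side_left // (@act_deg_single_gt0 _ _ gPhi Phi_pow _ EYz true).
have e0 m : coefz false (kernelYz m) = (m == 0%N)%:R.
  have := eq false m; rewrite big1 ?addr0 => [<-|i _]; first by case: (m).
  by case: (ci i (kernelYz (m - i.+1)) (cE false) (cE true) cF0 cF1).
split=> //; have := eq true n; rewrite [LHS](_ : _ = 0); last by case: (n).
move/esym/eqP; rewrite addr_eq0 => /eqP ->; congr (- _).
rewrite -[zeta_series X]mulr1 fpsXM_sum; apply: eq_bigr => i _.
case: (ci i (kernelYz (n - i.+1)) (cE false) (cE true) cF0 cF1) => _ ->.
by rewrite e0 /zeta_series -scalerAl.
Qed.

(* the coefficient of z in K(Y, z) = C(1, Y + z) K(1, Y, z) *)
Let right_bracketing n : coefz true (kernelYz n) =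
  (corr_series * (fun m => coefz true (kernel3 m)) : fps S) n +
  (derivY corr_series * kernel) n.
Proof.
have cE b f : coefz_rho b (E1_Yz true f) = coefz_rho b f by [].
have cF0 f : coefz_rho false (F1_Yz true f) = X * coefz_rho false f.
  rewrite -coefz_mulY; apply: fpsP => -[|t]; rewrite /coefz_rho /coefz /as_fps /=; pt.
have cF1 f : coefz_rho true (F1_Yz true f) = X * coefz_rho true f + coefz_rho false f.
  rewrite -coefz_mulY; apply: fpsP => -[|t]; rewrite fpsD /coefz_rho /coefz /as_fps /=; pt.
have Fo : F1_Yz false o2 = 0 by apply: fnP => -[[] [[] [|t]]]; pt.
pose H := harmonic_side Phi E1_Yz F1_Yz o2.
have eq : coefz_rho true (shuffle_side Phi E1_Yz F1_Yz o2 n) = coefz_rho true (H n) +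
    \sum_(i < n) coefz_rho true (correction Phi E1_Yz F1_Yz i (H (n - i.+1)%N)).
  rewrite (shuffle_harmonic gPhi Phi_pow E1_Yz_linear F1_Yz_linear EF1_Yz pentPhi erefl Fo n).
  by rewrite (linD (coefz_rho_linear true)) (lin_sum (coefz_rho_linear true)).
move: eq; rewrite {1 2}/coefz_rho /H shuffle_right harmonic_right => ->.
rewrite corr_series_mul -addrA; congr (_ + _).
transitivity (\sum_(i < n) (corr_coef i * coefz true (kernel3 (n - i.+1)) +
    fps_deriv (corr_coef i) * coefz false (kernel3 (n - i.+1)))).
  apply: eq_bigr => i _.
  rewrite (@correction_deriv _ E1_Yz F1_Yz (coefz_rho false) (coefz_rho true)
    (coefz_rho_linear true)) //.
  by rewrite /coefz_rho /H harmonic_right.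
rewrite big_split; congr (_ + _).
rewrite fpsM big_ord_recl [derivY corr_series _](_ : _ = 0) ?mul0r ?add0r; last exact: fps_deriv1.
by apply: eq_bigr => i _; case: (left_bracketing (n - i.+1)) => ->.
Qed.

(** Eliminating K(1, Y, z) between [left_bracketing] and [right_bracketing] gives the cocycle
    identity of C to first order in z, and K(1, Y) is removed by [corr_series_kernel]. *)
Theorem corr_series_ode :
  derivY corr_series = fpsX S * corr_series * (zeta_series (1 + X) - zeta_series X).
Proof.
have e : - (fpsX S * zeta_series X) =
    corr_series * - (fpsX S * (zeta_series (1 + X) * kernel)) + derivY corr_series * kernel.
  apply: fpsP => n; rewrite fpsN fpsD; case: (kernelYz_components n) => _ <-.
  rewrite right_bracketing; congr (_ + _).
  by rewrite !fpsM; apply: eq_bigr => i _; case: (left_bracketing (n - i)) => _ ->.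
have {e} := congr1 (fun f => f * corr_series) e.
rewrite mulrDl -[derivY corr_series * _ * _]mulrA (mulrC kernel) corr_series_kernel mulr1 => /eqP.
rewrite [X in _ == X]addrC -subr_eq => /eqP <-.
have -> : corr_series * - (fpsX S * (zeta_series (1 + X) * kernel)) * corr_series =
  - (fpsX S * zeta_series (1 + X) * corr_series * (corr_series * kernel)) by ring.
rewrite corr_series_kernel; ring.
Qed.

End Scalars.

(** * Solving the differential equation *)

(** The series h(T u); with u = 1, Y, 1 + Y these are h(x), h(y), h(x + y). *)
Definition homog (k : comNzRingType) (u h : fps k) : fps (fps k) := fun n => h n *: u ^+ n.

Section Solve.
Variable k : comAlgType rat.
Local Notation S := (fps k).
Local Notation X := (fpsX k).

Local Notation homog := (@homog k).

Lemma homogM u g h : homog u (g * h) = homog u g * homog u h.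
Proof.
apply: fpsP => n; rewrite /homog !fpsM scaler_suml; apply: eq_bigr => i _.
by rewrite -scalerAl -scalerAr scalerA -exprD subnKC // -ltnS.
Qed.

Lemma derivYM (f g : fps S) : derivY (f * g) = derivY f * g + f * derivY g.
Proof.
apply: fpsP => n; rewrite fpsD /derivY !fpsM fps_deriv_sum -big_split.
by apply: eq_bigr => i _; rewrite fps_derivM.
Qed.

Lemma derivYB (f g : fps S) : derivY (f - g) = derivY f - derivY g.
Proof. by apply: fpsP => n; rewrite fpsD fpsN /derivY fpsD fpsN fps_derivD fps_derivN. Qed.

Lemma derivY_homog1 h : derivY (homog 1 h) = 0.
Proof. by apply: fpsP => n; rewrite /derivY /homog expr1n fps_derivZ fps_deriv1 scaler0. Qed.

Lemma derivY_homog u h : fps_deriv u = 1 -> derivY (homog u h) = fpsX S * homog u (fps_deriv h).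
Proof.
move=> du; apply: fpsP => -[|n]; rewrite fpsXM /derivY /homog fps_derivZ.
  by rewrite expr0 fps_deriv1 scaler0.
by rewrite fps_derivXn du mulr1 -scalerMnr scalerMnl.
Qed.

Definition atY0 (f : fps S) : S := fun n => f n 0%N.

Lemma atY0M f g : atY0 (f * g) = atY0 f * atY0 g.
Proof.
apply: fpsP => n; rewrite /atY0 !fpsM fps_sum; apply: eq_bigr => i _.
by rewrite fpsM big_ord1.
Qed.

Lemma fps_expr0 (u : S) n : (u ^+ n) 0%N = u 0%N ^+ n.
Proof. by elim: n => // n IH; rewrite !exprS fpsM big_ord1 IH. Qed.

(** The factor T makes the coefficient of T^n of P depend on the previous ones only, up to a
    constant in Y, which vanishes by hypothesis. *)
Lemma ode_unique (P Q : fps S) : derivY P = fpsX S * Q * P -> atY0 P = 0 -> P = 0.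
Proof.
move=> dP P0; apply: fpsP => n; elim/ltn_ind: n => n IH.
have d : fps_deriv (P n) = 0.
  rewrite -[LHS]/(derivY P n) dP -mulrA fpsXM; case: n IH => // n IH.
  rewrite fpsM big1 // => i _; rewrite IH ?mulr0 //.
  by rewrite ltnS leq_subr.
apply: fpsP => -[|m]; first exact: (congr1 (fun f : S => f n) P0).
by apply: (@mulrn_eq0_rat _ _ m); apply: (congr1 (fun f : S => f m) d).
Qed.

Variables (Phi : Vhat k) (h : S).
Hypothesis gPhi : grouplikeV Phi.
Hypothesis Phi_pow : forall b n, Phi (nseq n.+1 b) = 0.
Hypothesis pentPhi : pentagon Phi.
Hypotheses (h0 : h 0%N = 1) (dh : fps_deriv h = (zeta Phi : S) * h).

(** Both sides solve the same differential equation in Y, and agree at Y = 0 where C = 1. *)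
Theorem corr_series_factor : corr_series Phi * (homog 1 h * homog X h) = homog (1 + X) h.
Proof.
have dX := fps_derivX k.
have d1X : fps_deriv (1 + X) = 1 by rewrite fps_derivD fps_deriv1 dX add0r.
have zE u : zeta_series Phi u = homog u (zeta Phi) by [].
apply/eqP; rewrite -subr_eq0; apply/eqP.
apply: (@ode_unique _ (homog (1 + X) (zeta Phi))).
  rewrite derivYB !derivYM derivY_homog1 !derivY_homog // dh !homogM.
  rewrite (corr_series_ode gPhi Phi_pow pentPhi) !zE; ring.
apply: fpsP => n; rewrite fps0 /atY0 !(fpsD, fpsN).
rewrite -[(corr_series Phi * _) n 0%N]/(atY0 (corr_series Phi * (homog 1 h * homog X h)) n) !atY0M.
have -> : atY0 (corr_series Phi) = 1.
  apply: fpsP => -[|i] //; rewrite /atY0 /= /corr_coef fps_sum big1 // => w _.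
  by rewrite fpsZ fps_expr0 exprS /fpsX mul0r mulr0.
have -> : atY0 (homog X h) = 1.
  apply: fpsP => -[|i]; rewrite /atY0 /homog fpsZ fps_expr0 /fpsX; first by rewrite h0 mulr1.
  by rewrite exprS mul0r mulr0.
rewrite mulr1 mul1r /atY0 /homog !fpsZ !fps_expr0 expr1n.
by rewrite fpsD /fpsX addr0 expr1n subrr.
Qed.

End Solve.

(** * The module M (x) M *)

Section TensorSquare.
Variable k : comNzRingType.
Local Notation L := (fn k (word * word)).

(** Left multiplication by a letter on the first factor of M (x) M. The test on the last
    letter accounts for e_0 1_DR = 0: the words ending with e_0 vanish in M. *)
Definition left_letter (a : bool) (f : L) : L := fun t =>
  if t.1 is c :: u then if (c == a) && last true t.1 then f (u, t.2) else 0 else 0.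
Definition right_letter (a : bool) (f : L) : L := fun t =>
  if t.2 is c :: v then if (c == a) && last true t.2 then f (t.1, v) else 0 else 0.
Definition one2 : L := fun t => ((t.1 == [::]) && (t.2 == [::]))%:R.
Local Notation E := left_letter.
Local Notation F := right_letter.

Lemma left_letter_linear a : linear (E a).
Proof.
move=> c f g; apply: fnP => -[[|b u] v]; rewrite /E !(fnD, fnZ) /=.
  by rewrite mulr0 addr0.
by case: ifP => _ //; rewrite mulr0 addr0.
Qed.

Lemma right_letter_linear a : linear (F a).
Proof.
move=> c f g; apply: fnP => -[u [|b v]]; rewrite /F !(fnD, fnZ) /=.
  by rewrite mulr0 addr0.
by case: ifP => _ //; rewrite mulr0 addr0.
Qed.

Lemma left_right_comm a b f : E a (F b f) = F b (E a f).
Proof.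
by apply: fnP => -[[|c u] [|d v]]; rewrite /E /F //=; case: ifP => // _; case: ifP.
Qed.

Lemma left_one2 : E false one2 = 0.
Proof. by apply: fnP => -[[|[] [|c u]] v] //=; rewrite /E /one2 /= if_same. Qed.

Lemma right_one2 : F false one2 = 0.
Proof. by apply: fnP => -[u [|[] [|c v]]] //=; rewrite /F /one2 /= ?andbF if_same. Qed.

Lemma last_behead (c : bool) (u : word) : last true (c :: u) -> last true u.
Proof. by case: u. Qed.

Lemma foldr_left_one2 w u v :
  foldr E one2 w (u, v) = [&& u == w, last true u & v == [::]]%:R.
Proof.
elim: w u => [|a w IH] [|c u] //.
rewrite [LHS]/= {1}/E /= -/(last true (c :: u)) eqseq_cons -andbA.
case: eqP => //= _; rewrite IH; case: ifP => [lu|_]; last by rewrite andbF.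
by rewrite (last_behead lu).
Qed.

Lemma foldr_right_one2 (f : word -> k) (x : L) w u v :
  (forall u v, x (u, v) = f u * (v == [::])%:R) ->
  foldr F x w (u, v) = f u * ((v == w) && last true v)%:R.
Proof.
move=> xE; elim: w v => [|a w IH] [|c v] //=; rewrite ?xE ?mulr0 //.
rewrite {1}/F /= -/(last true (c :: v)) eqseq_cons -andbA.
case: eqP => //= _; rewrite ?mulr0 // IH; case: ifP => [lv|_]; last by rewrite andbF mulr0.
by rewrite (last_behead lv).
Qed.

Lemma sum_words_delta (Phi : Vhat k) n u (c : word -> k) :
  (\sum_(w <- words n) Phi w * ((u == w)%:R * c w)) = if size u == n then Phi u * c u else 0.
Proof.
case: eqP => [su|/eqP su].
  rewrite (bigD1_seq u) ?words_uniq ?mem_words ?su //= eqxx mul1r big1 ?addr0 // => w.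
  by rewrite eq_sym => /negbTE ->; rewrite mul0r mulr0.
rewrite big_seq big1 // => w; rewrite mem_words => /eqP sw.
have [uw|_] := eqVneq u w; first by rewrite uw sw eqxx in su.
by rewrite mul0r mulr0.
Qed.

Lemma shuffle_side_tensor (Phi : Vhat k) n u v : last true u -> last true v ->
  shuffle_side Phi E F one2 n (u, v) = if n == (size u + size v)%N then Phi u * Phi v else 0.
Proof.
move=> lu lv; rewrite /shuffle_side fn_sum.
have hE m u' v' : act_deg Phi E m one2 (u', v') =
    (if size u' == m then Phi u' * (last true u')%:R else 0) * (v' == [::])%:R.
  rewrite /act_deg fn_sum; under eq_bigr => w _ do
    rewrite fnZ foldr_left_one2 -mulnb natrM -mulnb natrM.
  rewrite (sum_words_delta Phi m u' (fun=> (last true u')%:R * (v' == [::])%:R)).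
  by case: ifP => _; rewrite ?mul0r // mulrA.
have hF m j : act_deg Phi F j (act_deg Phi E m one2) (u, v) =
    if (size u == m) && (size v == j) then Phi u * Phi v else 0.
  rewrite /act_deg -/(act_deg Phi E m one2) fn_sum.
  transitivity ((if size u == m then Phi u else 0) *
      \sum_(w <- words j) Phi w * ((v == w)%:R * 1)).
    rewrite mulr_sumr; apply: eq_bigr => w _.
    rewrite fnZ (foldr_right_one2 _ _ _ (hE m)) lu lv andbT !mulr1 mulrCA; congr (_ * _).
  rewrite (sum_words_delta Phi j v (fun=> 1)) mulr1.
  by do 2 case: ifP => _ //=; rewrite ?mul0r ?mulr0.
under eq_bigr => i _ do rewrite hF.
case: eqP => [->|ne].
  have lt : (size v < (size u + size v).+1)%N by rewrite ltnS leq_addl.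
  rewrite (bigD1 (Ordinal lt)) //= addnK !eqxx big1 ?addr0 // => i ni.
  by case: ifP => // /andP[_ /eqP vi]; case/eqP: ni; apply: val_inj.
apply: big1 => i _; case: ifP => // /andP[/eqP su /eqP sv]; case: ne.
by rewrite su sv subnK // -ltnS.
Qed.

End TensorSquare.

(** * The harmonic coproduct in terms of the matrices *)

Section HarmonicCoproduct.
Variable k : comNzRingType.
Local Notation L := (fn k (word * word)).
Local Notation E := (@left_letter k).
Local Notation F := (@right_letter k).
Local Notation one2 := (one2 k).

(** Equality in M (x) M, whose basis consists of the words that do not end with e_0. *)
Definition agree (d : L) (G : V2hat k) :=
  forall u v, last true u -> last true v -> d (u, v) = G u v.

Lemma agree_foldr d G a b : agree d G ->
  agree (foldr E (foldr F d b) a) (smul2 (tens (smono k a) (smono k b)) G).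
Proof.
move=> dG u v lu lv; rewrite smul2_mono; elim: a u lu => [|c a IH] u lu /=.
  elim: b v lv => [|c b IH] v lv /=; first exact: dG.
  rewrite {1}/F; case: v lv => [|c' v] lv //=; rewrite (lv : last c' v = true) andbT.
  by case: eqP => _; rewrite ?mul0r // mul1r IH // (last_behead lv).
rewrite {1}/E; case: u lu => [|c' u] lu //=; rewrite (lu : last c' u = true) andbT.
by case: eqP => _; rewrite ?mul0r // mul1r IH // (last_behead lu).
Qed.

Definition y_word (i : nat) : word := if i is m.+1 then rcons (nseq m false) true else [::].
Definition y_sign (i : nat) : k := if i is 0 then 1 else -1.

Lemma yE i w : y k i w = y_sign i * smono k (y_word i) w.
Proof. by case: i => [|i]; rewrite /= ?mul1r ?mulN1r. Qed.

Lemma smul2_Deltay n (G : V2hat k) u v :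
  smul2 (Deltay k n) G u v = \sum_(i < n.+1) y_sign i * y_sign (n - i) *
    smul2 (tens (smono k (y_word i)) (smono k (y_word (n - i)))) G u v.
Proof.
rewrite /smul2 /Deltay.
under eq_bigr => a _ do under eq_bigr => b _ do rewrite mulr_suml.
under eq_bigr => a _ do rewrite exchange_big.
rewrite exchange_big /=; apply: eq_bigr => i _.
rewrite mulr_sumr; apply: eq_bigr => a _; rewrite mulr_sumr; apply: eq_bigr => b _.
by rewrite /tens !yE; ring.
Qed.

Definition mul_Deltay (n : nat) (d : L) : L := \sum_(i < n.+1) (y_sign i * y_sign (n - i)) *:
  foldr E (foldr F d (y_word (n - i))) (y_word i).

Lemma agree_mul_Deltay n d G : agree d G -> agree (mul_Deltay n d) (smul2 (Deltay k n) G).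
Proof.
move=> dG u v lu lv; rewrite smul2_Deltay /mul_Deltay fn_sum; apply: eq_bigr => i _.
by rewrite fnZ (agree_foldr _ _ dG).
Qed.

Let lE := @left_letter_linear k.
Let lF := @right_letter_linear k.
Let EF := @left_right_comm k.

Lemma foldr_yword (P : bool -> L -> L) m d :
  foldr P d (y_word m.+1) = iter m (P false) (P true d).
Proof. by rewrite /= foldr_rcons; elim: m => //= m ->. Qed.

(** opM false is triangular, with diagonal (E_0, F_0) and corner - E_1. *)
Lemma iter_opM m d :
  iter m (opM E F false) (E true d, F true d) =
  (iter m (E false) (E true d) -
     \sum_(i < m) iter i (E false) (E true (iter (m - i.+1) (F false) (F true d))),
   iter m (F false) (F true d)).
Proof.
elim: m => [|m IH]; first by rewrite big_ord0 subr0.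
rewrite iterS IH /= big_ord_recl /= subSS subn0.
rewrite (linB (lE false)) (lin_sum (lE false)) -addrA -opprD; congr (_ - _, _).
by rewrite addrC; congr (_ + _); apply: eq_bigr => i _; rewrite /bump /= subSS.
Qed.

Lemma mul_Deltay_linear n : linear (mul_Deltay n).
Proof.
move=> c d d'; rewrite /mul_Deltay scaler_sumr -big_split; apply: eq_bigr => i _.
by rewrite (linear_foldr _ lF) (linear_foldr _ lE) scalerDr !scalerA mulrC.
Qed.

Let dl (x : L * L) : L := x.1 + x.2.

(** The three kinds of terms in [iter_opM] are those of Delta(y_n): y_n (x) 1, 1 (x) y_n, and the
    products y_i (x) y_(n-i) with i between 1 and n - 1. *)
Lemma harmonic_block m x :
  dl (iter m (opM E F false) (opM E F true x)) = - mul_Deltay m.+1 (dl x).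
Proof.
case: x => p r; rewrite [opM E F true _]/= iter_opM /dl /= /mul_Deltay.
set d := p + r.
rewrite big_ord_recl big_ord_recr /= /bump !add1n add0n subnn /= mul1r mulr1 !scaleN1r.
rewrite -/(y_word m.+1) !foldr_yword.
rewrite [X in _ = - (_ + (X + _))](_ : _ =
    \sum_(i < m) iter i (E false) (E true (iter (m - i.+1) (F false) (F true d)))).
  by rewrite !opprD !opprK addrC (addrC (iter m (E false) (E true d))).
apply: eq_bigr => i _; rewrite !add1n add0n subSS -(subnSK (ltn_ord i)) /= mulrNN mulr1 scale1r.
by rewrite -!/(y_word _.+1) !foldr_yword.
Qed.

Lemma foldr_opM_false w : ~~ last true w -> foldr (opM E F) (one2, 0) w = 0.
Proof.
have lM := opM_linear lE lF.
elim/last_ind: w => // w [] _; rewrite last_rcons // => _.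
rewrite foldr_rcons [opM E F false _](_ : _ = 0) ?(lin0 (linear_foldr w lM)) //=.
by rewrite left_one2 (lin0 (lE true)) (lin0 (lF false)) subr0.
Qed.

(** The count n of letters e_0 already read, which [yblocks] carries along, is a power of
    opM false that still has to be applied. When w is empty it must be 0. *)
Lemma harmonic_word n w : last true w -> (w == [::]) ==> (n == 0%N) ->
  dl (iter n (opM E F false) (foldr (opM E F) (one2, 0) w)) =
  (-1) ^+ size (yblocks n w) *: foldr mul_Deltay one2 (yblocks n w).
Proof.
elim: w n => [|[] w IH] n lw /=.
- by move/eqP->; rewrite /= scale1r /dl /= addr0.
- move=> _; rewrite harmonic_block; have /= -> := IH 0%N (last_behead lw) (implybT _).
  by rewrite exprS -scalerA scaleN1r -(linZ (mul_Deltay_linear n.+1)).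
- have wn : w != [::] by case: (w) lw.
  by move=> _; rewrite -iterSr (IH n.+1) ?(negbTE wn) //; case: (w) wn lw.
Qed.

Lemma agree_foldr_mul_Deltay ns :
  agree (foldr mul_Deltay one2 ns) (foldr (fun n => smul2 (Deltay k n)) (sone2 k) ns).
Proof.
elim: ns => [|n ns IH] /=; last exact: agree_mul_Deltay.
by move=> u v _ _; rewrite /one2 /sone2 /tens /sone /smono /= -mulnb natrM.
Qed.

Lemma harmonic_side_DeltaW (g : Vhat k) u v : last true u -> last true v ->
  harmonic_side g E F one2 (size u + size v) (u, v) = DeltaW (liftM (toM g)) u v.
Proof.
move=> lu lv; rewrite /DeltaW.
rewrite (big_tuple_words _ (fun w => last true w)
  (fun w => liftM (toM g) w * DeltaW_word k w u v)).
have -> n : harmonic_side g E F one2 n = dl (act_deg g (opM E F) n (one2, 0)).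
  by rewrite /harmonic_side /dl; case: (act_deg _ _ _ _).
have ldl : linear dl by move=> c [p r] [p' r']; rewrite /dl /= scalerDr addrACA.
rewrite /act_deg (lin_sum ldl) fn_sum [RHS]big_mkcond; apply: eq_bigr => w _.
rewrite (linZ ldl) fnZ; case: ifP => [lw|/negbT lw]; last first.
  by rewrite foldr_opM_false // (lin0 ldl) mulr0.
rewrite /liftM insubT /toM /=; congr (_ * _).
have /= -> := @harmonic_word 0 w lw (implybT _).
by rewrite fnZ agree_foldr_mul_Deltay.
Qed.

End HarmonicCoproduct.

(** * Multiplication by series in e_1 *)

(** For fixed words u0, v0 that do not start with e_1, the coefficients of an element of
    M (x) M at the words (e_1^a u0, e_1^b v0) form a power series in T and Y, the coefficient of
    T^(a+b) Y^b. The multiplications by e_1 (x) 1 and 1 (x) e_1 become those by T and TY, so that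
    the identities between commutative series apply. *)
Section Evaluation.
Variable k : comNzRingType.
Local Notation S := (fps k).
Local Notation X := (fpsX k).
Local Notation L := (fn k (word * word)).
Local Notation E := (@left_letter k).
Local Notation F := (@right_letter k).
Local Notation one2 := (one2 k).

Variables u0 v0 : word.
Hypotheses (lu0 : last true u0) (lv0 : last true v0).
Hypotheses (hu0 : ~~ head false u0) (hv0 : ~~ head false v0).

Definition ones (a : nat) (u : word) : word := nseq a true ++ u.

Lemma last_ones a u : last true u -> last true (ones a u).
Proof.
move=> lu; rewrite /ones last_cat (_ : last true (nseq a true) = true) //.
by elim: a.
Qed.

Definition ev (m : nat) (f : L) : S := fun b =>
  if (b <= m)%N then f (ones (m - b) u0, ones b v0) else 0.

Lemma ev_linear m : linear (ev m).
Proof.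
move=> c f g; apply: fpsP => b; rewrite fpsD fpsZ /ev.
by case: ifP => _; rewrite ?fnD ?fnZ // mulr0 addr0.
Qed.

Lemma left_onesS a (x : L) v : E true x (ones a.+1 u0, v) = x (ones a u0, v).
Proof. by rewrite /E /= (last_ones a lu0 : last true (nseq a true ++ u0) = true). Qed.

Lemma left_ones0 (x : L) v : E true x (u0, v) = 0.
Proof. by rewrite /E; case: u0 hu0 => //= -[]. Qed.

Lemma right_onesS b (x : L) u : F true x (u, ones b.+1 v0) = x (u, ones b v0).
Proof. by rewrite /F /= (last_ones b lv0 : last true (nseq b true ++ v0) = true). Qed.

Lemma right_ones0 (x : L) u : F true x (u, v0) = 0.
Proof. by rewrite /F; case: v0 hv0 => //= -[]. Qed.

Lemma ev_left m x : ev m (E true x) = if m is m'.+1 then ev m' x else 0.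
Proof.
apply: fpsP => b; rewrite /ev; case: m => [|m].
  by case: b => [|b] //=; rewrite left_ones0.
case: leqP => [|bm]; last by rewrite ifF // leqNgt ltnW.
rewrite leq_eqVlt => /orP[/eqP-> | bm]; first by rewrite ltnn subnn left_ones0.
by rewrite -ltnS bm subSn // left_onesS.
Qed.

Lemma ev_right m x : ev m (F true x) = if m is m'.+1 then X * ev m' x else 0.
Proof.
apply: fpsP => -[|b].
  by rewrite /ev leq0n right_ones0; case: m => //= m; rewrite fpsXM.
rewrite /ev; case: m => [|m] //; rewrite fpsXM ltnS subSS.
by case: ifP => // _; rewrite right_onesS.
Qed.

Variable Phi : Vhat k.
Hypothesis gPhi : grouplikeV Phi.

Lemma ev_correction m i x :
  ev m (correction Phi E F i x) = if (i < m)%N then corr_coef Phi i * ev (m - i.+1) x else 0.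
Proof.
have evw w j : ev j (foldr (fun a : bool => if a then F true else E true) (F true x) w) =
    if (size w < j)%N then X ^+ (count id w).+1 * ev (j - (size w).+1) x else 0.
  elim: w j => [|[] w IH] [|j] //=; rewrite ?ev_right ?ev_left // ?IH ?subSS //.
  - by rewrite expr1 subn0.
  - by rewrite ltnS; case: ifP => _; rewrite ?mulr0 // mulrA add1n [in RHS]exprS.
rewrite /correction (lin_sum (ev_linear m)) big_seq.
under eq_bigr => w.
  rewrite mem_words => /eqP sw; rewrite (linZ (ev_linear m)) evw sw; over.
rewrite -big_seq; case: ifP => _; last by rewrite big1 // => w _; rewrite scaler0.
by rewrite /corr_coef mulr_suml; apply: eq_bigr => w _; rewrite scalerAl.
Qed.

Let s := (size u0 + size v0)%N.
(** For a sequence of homogeneous components, T^m sees the component of total degree m + s. *)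
Definition evs (x : nat -> L) : fps S := fun m => ev m (x (m + s)%N).

Hypothesis Phi_pow : forall b n, Phi (nseq n.+1 b) = 0.
Hypothesis pentPhi : pentagon Phi.

Lemma evs_shuffle_side :
  evs (shuffle_side Phi E F one2) = corr_series Phi * evs (harmonic_side Phi E F one2).
Proof.
apply: fpsP => m; rewrite corr_series_mul /evs.
rewrite (shuffle_harmonic gPhi Phi_pow (@left_letter_linear k) (@right_letter_linear k)
  (@left_right_comm k) pentPhi (left_one2 k) (right_one2 k)).
rewrite (linD (ev_linear m)) (lin_sum (ev_linear m)); congr (_ + _).
under eq_bigr => i _ do rewrite ev_correction.
rewrite -(big_mkord xpredT (fun i => if (i < m)%N then corr_coef Phi i * ev (m - i.+1)
  (harmonic_side Phi E F one2 (m + s - i.+1)) else 0)).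
rewrite (@big_cat_nat _ _ _ m) ?leq_addr //= [X in _ + X]big1_seq ?addr0.
  rewrite big_mkord; apply: eq_bigr => i _; rewrite ltn_ord.
  by rewrite addnC -addnBA // addnC.
by move=> i; rewrite mem_index_iota => /andP[_ /andP[mi _]]; rewrite ltnNge mi.
Qed.

Definition e1_series (h : nat -> k) : Vhat k := fun w => if all id w then h (size w) else 0.

Lemma smul_e1_nil h : smul (e1_series h) Phi [::] = h 0%N * Phi [::].
Proof. by rewrite /smul big_ord1. Qed.

Lemma smul_e1_cons h a w : smul (e1_series h) Phi (a :: w) =
  h 0%N * Phi (a :: w) + (if a then smul (e1_series (fun n => h n.+1)) Phi w else 0).
Proof.
rewrite /smul big_ord_recl; congr (_ + _).
case: a; last by apply: big1 => i _; rewrite /e1_series /= mul0r.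
by apply: eq_bigr.
Qed.

Lemma act_deg_twist (V : lmodType k) (P : bool -> V -> V) h n x : (forall a, linear (P a)) ->
  act_deg (smul (e1_series h) Phi) P n x =
  \sum_(m < n.+1) h m *: iter m (P true) (act_deg Phi P (n - m) x).
Proof.
move=> lP; elim: n h => [|n IH] h.
  by rewrite big_ord1 /act_deg !big_words0 smul_e1_nil /= scalerA.
have e a : \sum_(w <- words n) smul (e1_series h) Phi (a :: w) *: foldr P x (a :: w) =
    h 0%N *: (\sum_(w <- words n) Phi (a :: w) *: foldr P x (a :: w)) +
    (if a then P true (act_deg (smul (e1_series (fun n => h n.+1)) Phi) P n x) else 0).
  transitivity (\sum_(w <- words n) (h 0%N *: (Phi (a :: w) *: foldr P x (a :: w)) +
      (if a then smul (e1_series (fun n => h n.+1)) Phi w *: P true (foldr P x w) else 0))).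
    apply: eq_bigr => w _; rewrite smul_e1_cons scalerDl scalerA; congr (_ + _).
    by case: a => //; rewrite scale0r.
  rewrite big_split scaler_sumr /=; congr (_ + _); case: a; last by rewrite big1.
  by rewrite /act_deg (lin_sum (lP true)); apply: eq_bigr => w _; rewrite (linZ (lP true)).
rewrite big_ord_recl subn0 /= {1}/act_deg big_wordsS !e addr0 addrA -scalerDr.
rewrite -(big_wordsS n (fun w => Phi w *: foldr P x w)).
congr (_ + _); rewrite IH (lin_sum (lP true)); apply: eq_bigr => m _.
by rewrite (linZ (lP true)) /bump add1n subSS.
Qed.

(** The words e_1^a u are those for which a left factor e_1^i can be split off for i up to a. *)
Lemma smul_e1_ones h a u : ~~ head false u ->
  smul (e1_series h) Phi (ones a u) = \sum_(i < a.+1) h i * Phi (ones (a - i) u).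
Proof.
move=> hu; elim: a h => [|a IH] h.
  rewrite big_ord1 /ones; case: u hu => [|[] u] //= _; first by rewrite smul_e1_nil.
  by rewrite smul_e1_cons addr0.
rewrite [ones a.+1 u]/= smul_e1_cons -/(ones a u) IH [RHS]big_ord_recl subn0; congr (_ + _).
Qed.

Let dl (x : L * L) : L := x.1 + x.2.

Local Notation homog := (@homog k).

(** Since opM true has rank one, e_1 acts on the harmonic coproduct as E_1 + F_1, hence as
    T (1 + Y). *)
Lemma evs_twist (h : S) :
  evs (harmonic_side (smul (e1_series h) Phi) E F one2) =
  homog (1 + X) h * evs (harmonic_side Phi E F one2).
Proof.
have lM := opM_linear (@left_letter_linear k) (@right_letter_linear k).
have ldl : linear dl by move=> c [p r] [p' r']; rewrite /dl /= scalerDr addrACA.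
have harmonicE g n : harmonic_side g E F one2 n = dl (act_deg g (opM E F) n (one2, 0)).
  by rewrite /harmonic_side /dl; case: (act_deg _ _ _ _).
have evM m j x : ev j (dl (iter m (opM E F true) x)) =
    if (m <= j)%N then (1 + X) ^+ m * ev (j - m) (dl x) else 0.
  elim: m j => [|m IH] j; first by rewrite mul1r subn0.
  have -> : dl (iter m.+1 (opM E F true) x) =
      E true (dl (iter m (opM E F true) x)) + F true (dl (iter m (opM E F true) x)).
    by rewrite iterS /opM /dl; case: (iter _ _ _).
  rewrite (linD (ev_linear j)) ev_left ev_right; case: j => [|j]; first by rewrite addr0.
  rewrite IH ltnS subSS; case: ifP => _; last by rewrite mulr0 addr0.
  by rewrite exprS; ring.
apply: fpsP => m; rewrite fpsM /evs harmonicE act_deg_twist //.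
rewrite (lin_sum ldl) (lin_sum (ev_linear m)).
under eq_bigr => i _ do rewrite (linZ ldl) (linZ (ev_linear m)) evM.
rewrite -(big_mkord xpredT (fun i => h i *: (if (i <= m)%N then (1 + X) ^+ i * ev (m - i)
  (dl (act_deg Phi (opM E F) (m + s - i) (one2, 0))) else 0))).
rewrite (@big_cat_nat _ _ _ m.+1) ?ltnS ?leq_addr //= [X in _ + X]big1_seq ?addr0.
  rewrite big_mkord; apply: eq_bigr => i _; rewrite -ltnS ltn_ord -scalerAl harmonicE.
  by rewrite addnC -addnBA 1?addnC // -ltnS.
move=> i; rewrite mem_index_iota => /andP[_ /andP[mi _]].
by rewrite leqNgt mi scaler0.
Qed.

Lemma fpsXnM j (f : S) b : (X ^+ j * f) b = if (j <= b)%N then f (b - j)%N else 0.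
Proof.
elim: j b => [|j IH] b; first by rewrite mul1r subn0.
by rewrite exprS -mulrA fpsXM; case: b => // b; rewrite IH ltnS subSS.
Qed.

(** The tensor square of g; it is the same function in all degrees, as [evs] selects the
    component of the right degree. *)
Definition square (g : Vhat k) : nat -> L := fun _ t => g t.1 * g t.2.

Lemma evs_shuffle_side_square : evs (shuffle_side Phi E F one2) = evs (square Phi).
Proof.
apply: fpsP => m; apply: fpsP => b; rewrite /evs /ev; case: ifP => // bm.
rewrite shuffle_side_tensor ?last_ones // ifT // /ones !size_cat !size_nseq addnACA subnK //.
Qed.

Lemma sum_ord_trunc m b (f : nat -> k) :
  \sum_(i < m.+1) (if (b <= m - i)%N then f i else 0) =
  if (b <= m)%N then \sum_(i < (m - b).+1) f i else 0.
Proof.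
case: leqP => [bm|mb]; last by apply: big1 => i _; rewrite ifF //; lia.
rewrite (big_ord_widen m.+1 f) ?ltnS ?leq_subr // [RHS]big_mkcond /=.
by apply: eq_bigr => i _; have := ltn_ord i; do 2 case: ifP => //; lia.
Qed.

Lemma evs_square_twist (h : S) :
  evs (square (smul (e1_series h) Phi)) = homog 1 h * (homog X h * evs (square Phi)).
Proof.
have inner n b : (homog X h * evs (square Phi)) n b = if (b <= n)%N then
    Phi (ones (n - b) u0) * smul (e1_series h) Phi (ones b v0) else 0.
  rewrite fpsM fps_sum.
  transitivity (\sum_(j < n.+1) (if (b <= n)%N && (j < b.+1)%N then
      Phi (ones (n - b) u0) * (h j * Phi (ones (b - j) v0)) else 0)).
    apply: eq_bigr => j _; rewrite /homog -scalerAl fpsZ fpsXnM /evs /ev /square ltnS andbC.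
    have := ltn_ord j; rewrite ltnS => jn; case: leqP => jb; last by rewrite mulr0.
    have -> : (b - j <= n - j)%N = (b <= n)%N by lia.
    by case: ifP => bn; rewrite ?mulr0 // subnBA // subnK //= mulrCA.
  case: ifP => bn /=; last by rewrite big1.
  rewrite smul_e1_ones // mulr_sumr -big_mkcond /=.
  by rewrite -(big_ord_widen n.+1 (fun j => Phi (ones (n - b) u0) * (h j * Phi (ones (b - j) v0)))).
apply: fpsP => m; apply: fpsP => b; rewrite fpsM fps_sum.
transitivity (\sum_(i < m.+1) (if (b <= m - i)%N then
    (h i * Phi (ones (m - b - i) u0)) * smul (e1_series h) Phi (ones b v0) else 0)).
  rewrite (sum_ord_trunc m b (fun i => h i * Phi (ones (m - b - i) u0) * _)) /evs /ev.
  by case: ifP => // bm; rewrite /square /= smul_e1_ones // mulr_suml.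
apply: eq_bigr => i _; rewrite /homog expr1n -scalerAl mul1r fpsZ inner.
by case: ifP => _; rewrite ?mulr0 // mulrA subnAC.
Qed.

End Evaluation.

Section Harmonic.
Variables (k : comAlgType rat) (Phi : Vhat k) (h : fps k).
Hypothesis gPhi : grouplikeV Phi.
Hypothesis Phi_pow : forall b n, Phi (nseq n.+1 b) = 0.
Hypothesis pentPhi : pentagon Phi.
Hypotheses (h0 : h 0%N = 1) (dh : fps_deriv h = (zeta Phi : fps k) * h).

Lemma split_ones w : last true w ->
  exists a u, [/\ w = ones a u, last true u & ~~ head false u].
Proof.
elim: w => [|[] w IH] lw; first by exists 0%N, [::].
  have [a [u [-> lu hu]]] := IH (last_behead lw).
  by exists a.+1, u.
by exists 0%N, (false :: w).
Qed.

(** Multiplying [shuffle_harmonic] by h(E_1) h(F_1), the right side becomes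
    h(E_1 + F_1) Delta(Phi) = Delta(h(e_1) Phi) by [corr_series_factor]. *)
Theorem harmonic_twist u v : last true u -> last true v ->
  let g := smul (e1_series h) Phi in
  DeltaW (liftM (toM g)) u v = g u * g v.
Proof.
move=> lu lv g; rewrite -harmonic_side_DeltaW //.
have [a [u0 [-> lu0 hu0]]] := split_ones lu.
have [b [v0 [-> lv0 hv0]]] := split_ones lv.
have : evs u0 v0 (harmonic_side g (@left_letter k) (@right_letter k) (one2 k)) =
    evs u0 v0 (square g).
  rewrite (evs_twist lu0 lv0 hu0 hv0) (evs_square_twist lu0 lv0 hu0 hv0).
  rewrite -(evs_shuffle_side_square lu0 lv0) (evs_shuffle_side lu0 lv0 hu0 hv0 gPhi
    Phi_pow pentPhi).
  by rewrite -(corr_series_factor gPhi Phi_pow pentPhi h0 dh); ring.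
move/(congr1 (fun f : fps (fps k) => f (a + b)%N b)); rewrite /evs /ev leq_addl addnK.
by rewrite /square /= /ones !size_cat !size_nseq addnACA.
Qed.

End Harmonic.

(** * The factor Gamma *)

Section Exponential.
Variables (k : comAlgType rat) (f : fps k).
Hypothesis f0 : f 0%N = 0.

Lemma coef_poly_power N m n : (n <= N)%N ->
  ((\poly_(i < N.+1) f i) ^+ m)`_n = (f ^+ m : fps k) n.
Proof.
elim: m n => [|m IH] n nN; first by rewrite !expr0 coef1 fps1.
rewrite !exprS coefM fpsM; apply: eq_bigr => i _.
have iN : (i < N.+1)%N by rewrite (leq_trans (ltn_ord i)) // ltnS.
by rewrite coef_poly iN IH // (leq_trans (leq_subr _ _)).
Qed.

Lemma fps_power_small m n : (n < m)%N -> (f ^+ m : fps k) n = 0.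
Proof.
elim: m n => // m IH n nm; rewrite exprS fpsM big1 // => -[[|i] /= lt_i] _.
  by rewrite f0 mul0r.
by rewrite IH ?mulr0 //; lia.
Qed.

Lemma ps_expE N n : (n <= N)%N ->
  ps_exp f n = \sum_(m < N.+1) (m`!%:R^-1 : rat) *: (f ^+ m : fps k) n.
Proof.
move=> nN; rewrite /ps_exp.
rewrite (big_ord_widen N.+1 (fun m => (m`!%:R^-1 : rat) *: ((\poly_(i < n.+1) f i) ^+ m)`_n)) //.
rewrite big_mkcond; apply: eq_bigr => m _; case: ifP => [_|/negbT].
  by rewrite coef_poly_power.
by rewrite -leqNgt => nm; rewrite fps_power_small // scaler0.
Qed.

Lemma ps_exp0 : ps_exp f 0%N = 1.
Proof. by rewrite /ps_exp big_ord1 expr0 coef1 /= fact0 invr1 scale1r. Qed.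

(** Term by term, the derivative of f^(m+1) / (m+1)! is f' f^m / m!. *)
Lemma ps_exp_deriv : fps_deriv (ps_exp f : fps k) = fps_deriv f * ps_exp f.
Proof.
apply: fpsP => n; rewrite /fps_deriv (@ps_expE n.+1) // big_ord_recl.
rewrite expr0 fps1 scaler0 add0r mulrC fpsM.
transitivity (\sum_(m < n.+1) (m`!%:R^-1 : rat) *: ((f ^+ m * fps_deriv f : fps k) n)).
  rewrite -sumrMnl; apply: eq_bigr => m _; rewrite lift0 scalerMnr.
  rewrite -[(f ^+ m.+1) n.+1 *+ n.+1]/(fps_deriv (f ^+ m.+1) n) fps_derivXn fpsMn.
  rewrite -scaler_nat scalerA; congr (_ *: _).
  rewrite factS natrM invfM mulrAC mulVf ?mul1r //.
  by rewrite Num.Theory.pnatr_eq0.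
under eq_bigr => m _ do rewrite fpsM scaler_sumr.
rewrite exchange_big; apply: eq_bigr => i _.
rewrite (@ps_expE n) -1?ltnS // mulr_suml; apply: eq_bigr => m _.
by rewrite -scalerAl.
Qed.

End Exponential.

Section GammaFactor.
Variables (k : comAlgType rat) (Phi : Vhat k).

Let logh : fps k := fun n => if n is m.+1 then (n%:R^-1 : rat) *: zeta Phi m else 0.

(** h(t) = exp(sum_n zeta_n t^n / n). *)
Definition inv_gamma : fps k := ps_exp logh.
(** Gamma_Phi(-t). *)
Definition gamma_neg : fps k := fun n => (-1) ^+ n * Gamma Phi n.

Lemma rat_natK (x : k) n : ((n.+1%:R^-1 : rat) *: x) *+ n.+1 = x.
Proof.
by rewrite -scaler_nat scalerA mulfV ?scale1r // Num.Theory.pnatr_eq0.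
Qed.

Lemma inv_gamma0 : inv_gamma 0%N = 1. Proof. exact: ps_exp0. Qed.

Lemma inv_gamma_deriv : fps_deriv inv_gamma = (zeta Phi : fps k) * inv_gamma.
Proof.
rewrite ps_exp_deriv //; congr (_ * _); apply: fpsP => n.
exact: rat_natK.
Qed.

Lemma gamma_neg_deriv : fps_deriv gamma_neg = - ((zeta Phi : fps k) * gamma_neg).
Proof.
apply: fpsP => n; rewrite fpsN fpsM /fps_deriv /gamma_neg -mulrnAr.
set G := (fun n => if n is m.+1 then (n%:R^-1 : rat) *:
  ((-1) ^+ n.+1 * Phi (rcons (nseq m false) true)) else 0) : fps k.
rewrite -[Gamma Phi n.+1 *+ n.+1]/(fps_deriv (ps_exp G : fps k) n) ps_exp_deriv // fpsM.
rewrite mulr_sumr -sumrN; apply: eq_bigr => i _.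
rewrite {1}/fps_deriv rat_natK -/(zeta Phi i) -[ps_exp G _]/(Gamma Phi (n - i)).
have /subnKC {1}<- : (i <= n)%N by rewrite -ltnS.
have sq : ((-1) ^+ i * (-1) ^+ i : k) = 1.
  by rewrite -exprD addnn -mul2n exprM sqrrN expr1n expr1n.
rewrite !exprS exprD; move: ((-1) ^+ i) ((-1) ^+ (n - i)) sq => e e' ee.
by rewrite -[RHS]mul1r -[X in X * - _]ee; ring.
Qed.

(** The logarithmic derivatives are opposite, so the product is constant. *)
Lemma gammaM : gamma_neg * inv_gamma = 1.
Proof.
have d : fps_deriv (gamma_neg * inv_gamma) = 0.
  by rewrite fps_derivM gamma_neg_deriv inv_gamma_deriv; ring.
apply: fpsP => -[|n].
  by rewrite fpsM big_ord1 inv_gamma0 mulr1 /gamma_neg mul1r; apply: ps_exp0.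
by apply: (@mulrn_eq0_rat _ _ n); apply: (congr1 (fun f : fps k => f n) d).
Qed.

End GammaFactor.

Section OneVariable.
Variable k : comNzRingType.

Lemma smul_letter (a : word) (G : Vhat k) w : smul (smono k a) G w = foldr (@lcons k) G a w.
Proof. by rewrite -sum_take. Qed.

Lemma spow_e1 n w :
  spow (sopp (smono k [:: true])) n w = (-1) ^+ n * (w == nseq n true)%:R.
Proof.
elim: n w => [|n IH] w; first by rewrite mul1r.
have -> : spow (sopp (smono k [:: true])) n.+1 w =
    - smul (smono k [:: true]) (spow (sopp (smono k [:: true])) n) w.
  by rewrite /= /smul -sumrN; apply: eq_bigr => i _; rewrite /sopp mulNr.
rewrite smul_letter; case: w => [|b w] /=; first by rewrite oppr0 mulr0.
by rewrite IH exprS eqseq_cons mulN1r mulNr -mulnb natrM mulrCA.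
Qed.

Lemma all_ones w : all id w -> w = nseq (size w) true.
Proof. by elim: w => //= -[] w IH //= /IH {1}->. Qed.

Lemma ps_eval_e1 (f : nat -> k) w :
  ps_eval f (sopp (smono k [:: true])) w = e1_series (fun n => (-1) ^+ n * f n) w.
Proof.
rewrite /ps_eval /e1_series; under eq_bigr => n _ do rewrite spow_e1.
case: ifP => [/all_ones|] wE.
  rewrite big_ord_recr /= -wE eqxx mulr1 mulrC big1 ?add0r // => i _.
  case: eqP => [/(congr1 size)|_]; last by rewrite !mulr0.
  by rewrite size_nseq => wi; have := ltn_ord i; rewrite -wi ltnn.
apply: big1 => i _; case: eqP => [wi|_]; last by rewrite !mulr0.
have : all id w by rewrite [w in all _ w]wi all_nseq orbT.
by rewrite wE.
Qed.

Lemma smul_e1_series (f g : fps k) :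
  smul (e1_series f) (e1_series g) =1 e1_series (f * g : fps k).
Proof.
move=> w; rewrite /smul /e1_series; case: ifP => wE.
  rewrite fpsM; apply: eq_bigr => i _; have iw : (i <= size w)%N by rewrite -ltnS.
  have := wE; rewrite -{1}(cat_take_drop i w) all_cat => /andP[-> ->].
  by rewrite size_drop size_takel.
apply: big1 => i _; move: wE; rewrite -{1}(cat_take_drop i w) all_cat.
by do 2 case: all => //=; rewrite ?mul0r ?mulr0.
Qed.

Lemma e1_series1 : e1_series (1 : fps k) =1 sone k.
Proof. by case=> [|a w]; rewrite /e1_series /sone /smono //= fps1 if_same. Qed.

Lemma smul_one (g : Vhat k) : smul g (sone k) = g.
Proof.
apply: funext => w; rewrite /smul big_ord_recr /= take_size drop_size mulr1 big1 ?add0r //.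
move=> i _; rewrite /sone /smono -size_eq0 size_drop subn_eq0 leqNgt ltn_ord mulr0 //.
Qed.

Lemma Mact_oneM (g : Vhat k) : Mact g (oneM k) = toM g.
Proof.
rewrite /Mact (_ : liftM (oneM k) = sone k) ?smul_one //; apply: funext => w.
rewrite /liftM /oneM /toM; case: insubP => [u _ <- //|lw].
by case: w lw.
Qed.

End OneVariable.

(** * The theorem *)

Theorem theorem3p3 (k : comUnitAlgType rat) (mu : k) (hmu : mu \is a GRing.unit)
  (Phi : Vhat k) (hPhi : associator mu Phi) : DMR mu Phi.
Proof.
case: hPhi => gPhi pentPhi Phi0 Phi1 Phi01.
have Phi_pow b n : Phi (nseq n.+1 b) = 0 by apply: grouplike_power => //; case: b.
split=> //; exists (e1_series (inv_gamma Phi)).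
have gE : ps_eval (Gamma Phi) (sopp (smono k [:: true])) = e1_series (gamma_neg Phi).
  by apply: funext => w; rewrite ps_eval_e1.
split.
  rewrite gE; split=> w; rewrite smul_e1_series ?gammaM ?(mulrC (inv_gamma Phi)) ?gammaM;
    exact: e1_series1.
rewrite Mact_oneM; split.
  move=> u v; rewrite /DeltaM /toM2 (harmonic_twist gPhi Phi_pow pentPhi
    (inv_gamma0 Phi) (inv_gamma_deriv Phi)) //; exact: valP.
rewrite /liftM insubT /toM /= smul_e1_nil.
by rewrite inv_gamma0 mul1r (grouplike_nil gPhi).
Qed.
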